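(* Let $d\geqslant2$ be a fixed integer and let $P$ be the transition matrix of a random $d$-regular digraph on $n$ vertices. Let $|\lambda_n|\leqslant\dots\leqslant|\lambda_2|\leqslant\lambda_1=1$ be the eigenvalues of $P$, ordered by decreasing modulus. Then for every fixed $\varepsilon>0$, with probability tending to $1$ as $n\to\infty$, $$|\lambda_2|\leqslant\frac1{\sqrt d}+\varepsilon .$$
   Context: The random $d$-regular digraph is the directed configuration model with all in- and out-degrees equal to $d$: each vertex $i\in\{1,\dots,n\}$ carries a set $E^+(i)$ of $d$ half-edges called heads and a set $E^-(i)$ of $d$ half-edges called tails; $\sigma$ is a uniformly random bijection from the set of all $dn$ heads to the set of all $dn$ tails; each head $\mathbf e\in E^+(u)$ with $\sigma(\mathbf e)\in E^-(v)$ yields a directed edge from $u$ to $v$ (loops and multiple edges are allowed). The transition matrix is $P(u,v)=\frac1d\#\{\mathbf e\in E^+(u):\sigma(\mathbf e)\in E^-(v)\}$. Eigenvalues are the complex roots of the characteristic polynomial, counted with multiplicity. *)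

(* Defs.v *)
From HB Require Import structures.
From mathcomp Require Import all_boot all_order all_fingroup all_algebra.
From mathcomp Require Import all_classical all_reals all_analysis.
From mathcomp Require Import complex.

Set Implicit Arguments.
Unset Strict Implicit.
Unset Printing Implicit Defensive.

Import Order.TTheory GRing.Theory Num.Theory.
Import numFieldNormedType.Exports.

Local Open Scope ring_scope.
Local Open Scope complex_scope.

(* (i, a) is the a-th head, and also the a-th tail, of vertex i: heads and tails
   are two disjoint copies of the same label set. *)
Definition half_edge (n d : nat) : finType := ('I_n * 'I_d)%type.

(* A bijection from heads to tails, encoded as a permutation of the labels. *)
Definition matching (n d : nat) : finType := {perm half_edge n d}.

Definition half_edges_of (n d : nat) (u : 'I_n) : {set half_edge n d} :=
  [set e | e.1 == u]%SET.

Definition transition_matrix (R : realType) (n d : nat) (sigma : matching n d) :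
    'M[R[i]]_n :=
  \matrix_(u, v)
    (#|[set e in half_edges_of d u | sigma e \in half_edges_of d v]%SET|%:R / d%:R).

Definition finite_uniform_prob (R : realType) (T : finType) (E : {set T}) : R :=
  #|E|%:R / #|T|%:R.

(* The eigenvalues lambda_1, lambda_2, ... of A are l`_0, l`_1, ... *)
Definition ordered_spectrum (R : realType) (n : nat) (A : 'M[R[i]]_n)
    (l : seq R[i]) : Prop :=
  [/\ char_poly A = \prod_(z <- l) ('X - z%:P),
      sorted (fun x y => `|y| <= `|x|) l
    & l`_0 = 1].

Section Existence.
Variables (R : realType) (n d : nat) (sigma : matching n d).
Hypothesis d_gt0 : (0 < d)%N.
Let P := transition_matrix R sigma.

Let dN0 : d%:R != 0 :> R[i]. Proof. by rewrite pnatr_eq0 -lt0n. Qed.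

Lemma card_half_edges_of (u : 'I_n) : #|half_edges_of d u| = d.
Proof.
have -> : half_edges_of d u = finset.setX [set u]%SET [set: 'I_d]%SET.
  by apply/finset.setP => -[i a]; rewrite !inE andbT.
by rewrite cardsX cards1 cardsT card_ord mul1n.
Qed.

Lemma transition_matrix_row_sum u : \sum_v P u v = 1.
Proof.
under eq_bigr do rewrite mxE.
rewrite -mulr_suml -natr_sum.
suff -> : (\sum_v #|[set e in half_edges_of d u |
    sigma e \in half_edges_of d v]| = d)%N by rewrite divff.
rewrite -[RHS](card_half_edges_of u) -sum1_card.
rewrite (partition_big (fun e => (sigma e).1) xpredT) //=.
apply: eq_bigr => v _; rewrite -sum1_card; apply: eq_bigl => e.
by rewrite !inE.
Qed.

Lemma transition_matrix_col_sum v : \sum_u P u v = 1.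
Proof.
under eq_bigr do rewrite mxE.
rewrite -mulr_suml -natr_sum.
suff -> : (\sum_u #|[set e in half_edges_of d u |
    sigma e \in half_edges_of d v]| = d)%N by rewrite divff.
rewrite -[RHS](card_half_edges_of v).
rewrite -(card_preimset (half_edges_of d v) (@perm_inj _ sigma)) -sum1_card.
rewrite (partition_big (fun e => e.1) xpredT) //=.
apply: eq_bigr => u _; rewrite -sum1_card; apply: eq_bigl => e.
by rewrite !inE andbC.
Qed.

Lemma transition_matrix_ge0 u v : 0 <= P u v.
Proof. by rewrite mxE divr_ge0 // ler0n. Qed.

Lemma transition_matrix_root_norm z : root (char_poly P) z -> `|z| <= 1.
Proof.
rewrite -eigenvalue_root_char => /eigenvalueP[x xP xN0].
have sx_gt0 : 0 < \sum_j `|x 0 j|.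
  rewrite lt0r sumr_ge0 // andbT; apply: contra xN0 => /eqP s0.
  apply/eqP/rowP => j; rewrite mxE; apply/eqP; rewrite -normr_eq0.
  move/eqP: s0; rewrite psumr_eq0 // => /allP/(_ j).
  by rewrite mem_index_enum => /(_ isT).
rewrite -(ler_pM2r sx_gt0) mul1r mulr_sumr.
apply: (@le_trans _ _ (\sum_j \sum_i `|x 0 i| * P i j)).
  apply: ler_sum => j _; move/rowP/(_ j): xP; rewrite !mxE => xPj.
  rewrite -normrM -xPj; apply: (le_trans (ler_norm_sum _ _ _)).
  by apply: ler_sum => i _; rewrite normrM (ger0_norm (transition_matrix_ge0 _ _)).
rewrite exchange_big /=; apply: ler_sum => i _.
by rewrite -mulr_sumr transition_matrix_row_sum mulr1.
Qed.

Lemma ordered_spectrum_exists : (0 < n)%N -> exists l, ordered_spectrum P l.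
Proof.
move=> n_gt0.
have [r rE] := closed_field_poly_normal (char_poly P).
rewrite (monicP (char_poly_monic P)) scale1r in rE.
have r1 : 1 \in r.
  rewrite -root_prod_XsubC -rE -eigenvalue_root_char; apply/eigenvalueP.
  exists (const_mx 1).
    apply/rowP => v; rewrite !mxE mulr1 -[RHS](transition_matrix_col_sum v).
    by apply: eq_bigr => u _; rewrite !mxE mul1r.
  apply/eqP => /rowP/(_ (Ordinal n_gt0)); rewrite !mxE => /eqP.
  by rewrite oner_eq0.
have r_le1 z : z \in r -> `|z| <= 1.
  by rewrite -root_prod_XsubC -rE; exact: transition_matrix_root_norm.
pose ge := fun x y : R[i] => `|y| <= `|x|.
have ge_total : total ge by move=> x y; exact: real_leVge.
exists (1 :: sort ge (rem 1 r)); split=> //.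
- rewrite rE; apply: perm_big; apply: (perm_trans (perm_to_rem r1)).
  by rewrite perm_cons perm_sym perm_sort.
- rewrite /= path_min_sorted ?sort_sorted //; apply/allP => z.
  by rewrite mem_sort => /mem_rem/r_le1; rewrite normr1.
Qed.

End Existence.

(* Main.v *)
Require Import Defs.
From HB Require Import structures.
From mathcomp Require Import all_boot all_order all_fingroup all_algebra.
From mathcomp Require Import all_classical all_reals all_analysis.
From mathcomp Require Import complex.
From mathcomp Require Import ring lra zify.

(* Write q(z) for the product of the 1 - z mu over the nontrivial eigenvalues mu of P.

   Upper bounds for q: up to sign its i-th coefficient is the trace of the i-th
   exterior power of the centered matrix P - J/n.  It is a matrix coefficient of
   the i-th exterior power of the standard representation of the symmetric group
   on the nd half-edges; this representation is irreducible, so Schur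
   orthogonality computes the second moment exactly, and it is at most d^(-i) for
   all n and all i.

   Bounds for 1/q: by Newton's identities the first K coefficients of 1/q are
   controlled by the first K power sums of the mu, and the k-th one is
   (number of closed walks of length k) / d^k - 1.  For fixed k the expected number
   of closed walks leaving some vertex by two different heads tends to 0, so up to
   periodic ones the closed walks are the simple cycles, and the second moment of
   their number is computed directly; the power sums are thus of order
   d^(-k/2) up to a polynomial factor in k.

   Hence on the disk |z| <= 1/rho with rho > 1/sqrt d, the polynomial q times the
   truncation of 1/q to order K is 1 + O(poly(K) theta^K) with theta < 1, with
   high probability, so that q has no zero there. *)

Set Implicit Arguments.
Unset Strict Implicit.
Unset Printing Implicit Defensive.

Import Order.TTheory GRing.Theory Num.Theory.
Import numFieldNormedType.Exports.

Local Open Scope classical_set_scope.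
Local Open Scope ring_scope.
Local Open Scope complex_scope.

(** * Minors, Cauchy-Binet and characteristic polynomials *)

(** Long walks are never counted: K stays fixed while n grows, because the second moments of the
    coefficients of q are available in every degree. Take a strictly between 1/sqrt d and rho and
    put beta = 1/(d a^2) < 1. The second moments, rescaled by the matching powers of a, are then
    bounded by the summable beta^i for the coefficients and, up to O(1/n), by i^2 beta^i for the
    walk counts. One Markov inequality thus gives |q_i| <= b a^i for all i together with the bounds
    on the first K walk counts. Neither sum depends on K, so b is fixed by the allowed failure
    probability, then K by b, then n by both. Exterior powers are modelled by functions on arbitrary
    k-tuples. Tuples with a repetition contribute zero and each k-subset is counted k! times, which
    explains the factors k! of the algebraic part. *)

Definition minor (R : comNzRingType) (T U : Type) (k : nat) (K : T -> U -> R)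
    (f : 'I_k -> T) (g : 'I_k -> U) : R :=
  \det (\matrix_(i, j) K (f i) (g j)).

Lemma det_row_expand (R : comNzRingType) (T : finType) (k : nat)
    (a : 'I_k -> T -> R) (b : T -> 'I_k -> R) :
  \det (\matrix_(i, j) \sum_x a i x * b x j) =
  \sum_(f : {ffun 'I_k -> T})
    (\prod_i a i (f i)) * \det (\matrix_(i, j) b (f i) j).
Proof.
transitivity (\sum_(f : {ffun 'I_k -> T}) \sum_(s : 'S_k)
    (-1) ^+ s * \prod_i (a i (f i) * b (f i) (s i))).
  rewrite exchange_big; apply: eq_bigr => /= s _; rewrite -big_distrr /=.
  congr (_ * _); rewrite -(bigA_distr_bigA (fun i x => a i x * b x (s i))) /=.
  by apply: eq_bigr => x _; rewrite mxE.
apply: eq_bigr => f _; rewrite /determinant big_distrr /=.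
apply: eq_bigr => s _; rewrite mulrCA big_split //=; congr (_ * (_ * _)).
by apply: eq_bigr => x _; rewrite mxE.
Qed.

Lemma minor_perml (R : comNzRingType) (T U : Type) (k : nat) (K : T -> U -> R)
    (f : 'I_k -> T) (g : 'I_k -> U) (s : 'S_k) :
  minor K (fun i => f (s i)) g = (-1) ^+ s * minor K f g.
Proof.
rewrite /minor -det_perm -det_mulmx -row_permE; congr (\det _).
by apply/matrixP => i j; rewrite !mxE.
Qed.

Lemma minor_tr (R : comNzRingType) (T U : Type) (k : nat) (K : T -> U -> R)
    (f : 'I_k -> T) (g : 'I_k -> U) :
  minor K f g = minor (fun x y => K y x) g f.
Proof.
rewrite /minor -det_tr; congr (\det _).
by apply/matrixP => i j; rewrite !mxE.
Qed.

Lemma minor_permr (R : comNzRingType) (T U : Type) (k : nat) (K : T -> U -> R)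
    (f : 'I_k -> T) (g : 'I_k -> U) (s : 'S_k) :
  minor K f (fun i => g (s i)) = (-1) ^+ s * minor K f g.
Proof. by rewrite minor_tr minor_perml -minor_tr. Qed.

Lemma reindex_ffun_perm (R : nmodType) (T : finType) (k : nat) (s : 'S_k)
    (F : {ffun 'I_k -> T} -> R) :
  \sum_f F f = \sum_(f : {ffun 'I_k -> T}) F [ffun i => f (s i)].
Proof.
rewrite (reindex_inj (h := fun f : {ffun 'I_k -> T} => [ffun i => f (s i)])) //.
move=> f g /ffunP fg; apply/ffunP => i.
by have := fg ((s^-1)%g i); rewrite !ffunE permKV.
Qed.

Lemma cauchy_binet (R : comNzRingType) (T V : Type) (X : finType) (k : nat)
    (K : T -> X -> R) (L : X -> V -> R) (f : 'I_k -> T) (h : 'I_k -> V) :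
  \sum_(g : {ffun 'I_k -> X}) minor K f g * minor L g h =
  k`!%:R * minor (fun x z => \sum_y K x y * L y z) f h.
Proof.
(* All k! permutations in the expansion of the first minor contribute equally: relabelling [g] by
   [s] moves a sign into the second minor, where it cancels. *)
transitivity (\sum_(s : 'S_k) \sum_(g : {ffun 'I_k -> X})
    (\prod_i K (f i) (g i)) * minor L g h).
  rewrite exchange_big /=.
  under eq_bigr do rewrite /minor /determinant mulr_suml.
  rewrite exchange_big [RHS]exchange_big /=; apply: eq_bigr => s _.
  rewrite [RHS](reindex_ffun_perm s); apply: eq_bigr => g _.
  under [X in _ = _ * X]eq_bigr do under eq_bigr do rewrite mxE ffunE.
  have -> : \sum_(t : 'S_k) (-1) ^+ t * \prod_i L (g (s i)) (h (t i)) =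
      minor L (fun i => g (s i)) h.
    by apply: eq_bigr => t _; congr (_ * _); apply: eq_bigr => i _; rewrite mxE.
  rewrite minor_perml.
  rewrite mulrCA mulrA; congr (_ * _ * _).
  by apply: eq_bigr => i _; rewrite mxE ffunE.
rewrite sumr_const card_Sn mulr_natl; congr (_ *+ _).
by rewrite /minor (det_row_expand (fun i y => K (f i) y) (fun y j => L y (h j))).
Qed.

(* Up to a factor [k!], the k-th elementary symmetric function of the eigenvalues of
  [B] *)
Definition minor_sum (R : comNzRingType) (n : nat) (B : 'M[R]_n) (k : nat) : R :=
  \sum_(u : {ffun 'I_k -> 'I_n}) minor B u u.

(** Row expansion of the left factor leaves, for each intermediate tuple, a sum which the same
    expansion recognizes as a minor of the swapped product. Conjugation invariance follows, so
    [minor_sum] can be computed on a triangular form. *)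
Lemma minor_sum_mulC (R : comNzRingType) (n k : nat) (A B : 'M[R]_n) :
  minor_sum (A *m B) k = minor_sum (B *m A) k.
Proof.
have expand (C D : 'M[R]_n) (u : {ffun 'I_k -> 'I_n}) : minor (C *m D) u u =
    \sum_(w : {ffun 'I_k -> 'I_n}) (\prod_i C (u i) (w i)) * minor D w u.
  rewrite -(det_row_expand (fun i y => C (u i) y) (fun y j => D y (u j))).
  by congr (\det _); apply/matrixP => i j; rewrite !mxE.
rewrite /minor_sum; under eq_bigr do rewrite expand.
rewrite exchange_big /=; apply: eq_bigr => w _.
rewrite minor_tr.
transitivity (\det (\matrix_(i, j) \sum_u A u (w i) * B (w j) u)); last first.
  congr (\det _); apply/matrixP => i j; rewrite !mxE.
  by apply: eq_bigr => u _; rewrite mulrC.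
rewrite (det_row_expand (fun i y => A y (w i)) (fun y j => B (w j) y)).
by apply: eq_bigr => u _; rewrite minor_tr.
Qed.

Lemma minor_eq0 (R : idomainType) (T U : Type) (k : nat) (K : T -> U -> R)
    (f : 'I_k -> T) (g : 'I_k -> U) (i j : 'I_k) :
  i != j -> f i = f j -> minor K f g = 0.
Proof.
by move=> ij fij; apply: (determinant_alternate ij) => l; rewrite !mxE fij.
Qed.

Lemma sum_image_inj_ffun (R : pzRingType) (n k : nat) (G : {set 'I_n} -> R) :
  \sum_(u : {ffun 'I_k -> 'I_n} | injectiveb u) G [set u i | i in 'I_k]%SET =
  k`!%:R * \sum_(I : {set 'I_n} | #|I| == k) G I.
Proof.
rewrite (partition_big (fun u : {ffun 'I_k -> 'I_n} => [set u i | i in 'I_k]%SET)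
  (fun I => #|I| == k)) /=; last first.
  by move=> u /injectiveP uI; rewrite card_imset // card_ord.
rewrite mulr_sumr; apply: eq_bigr => I /eqP cI.
rewrite (eq_bigr (fun=> G I)); last by move=> u /andP[_ /eqP->].
rewrite sumr_const mulr_natl; congr (_ *+ _).
have := card_inj_ffuns_on 'I_k (mem I).
rewrite card_ord cI ffactnn => <-; apply: eq_card => u.
rewrite !inE /in_mem /= andbC; case: (boolP (injectiveb u)) => uI; last by rewrite !andbF.
rewrite !andbT; apply/eqP/ffun_onP => [<- i|uS]; first exact: imset_f.
apply/eqP; rewrite eqEcard cI card_imset; last exact/injectiveP.
by rewrite card_ord leqnn andbT; apply/fintype.subsetP => x /imsetP[i _ ->].
Qed.

Lemma coef_prod_1subZX (R : comNzRingType) (n k : nat) (c : 'I_n -> R) :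
  (\prod_i (1 - c i *: 'X))`_k =
  (-1) ^+ k * \sum_(I : {set 'I_n} | #|I| == k) \prod_(i in I) c i.
Proof.
have -> : \prod_i (1 - c i *: 'X) =
    \sum_(I : {set 'I_n}) ((-1) ^+ #|I| * \prod_(i in I) c i) *: 'X^#|I|.
  under eq_bigr do rewrite addrC.
  rewrite bigA_distr /=; apply: eq_bigr => I _.
  rewrite -big_mkcond /= (eq_bigr (fun i => (- c i) *: 'X)); last first.
    by move=> i _; rewrite scaleNr.
  by rewrite scaler_prodr -prodrN.
rewrite coef_sum mulr_sumr [RHS]big_mkcond /=; apply: eq_bigr => I _.
by rewrite coefZ coefXn eq_sym; case: eqP => [->|_]; rewrite ?mulr1 ?mulr0.
Qed.

Lemma perm_prod_XsubC (R : idomainType) (s t : seq R) :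
  \prod_(z <- s) ('X - z%:P) = \prod_(z <- t) ('X - z%:P) -> perm_eq s t.
Proof.
elim: s t => [|x s IHs] t st.
  have := size_prod_XsubC t id; rewrite -st big_nil size_poly1.
  by case: t {st}.
have xt : x \in t by rewrite -root_prod_XsubC -st root_prod_XsubC mem_head.
rewrite perm_sym (perm_trans (perm_to_rem xt)) // perm_cons perm_sym.
apply: IHs; apply: (mulfI (negbT (polyXsubC_eq0 x))).
by move: st; rewrite (perm_big _ (perm_to_rem xt)) /= !big_cons.
Qed.

Lemma char_poly_conj (R : comUnitRingType) (n : nat) (S B : 'M[R]_n) :
  S \in unitmx -> char_poly (S *m B *m invmx S) = char_poly B.
Proof.
move=> Su; rewrite /char_poly.
have SV : map_mx polyC S *m map_mx polyC (invmx S) = 1%:M.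
  by rewrite -map_mxM mulmxV // map_mx1.
have -> : char_poly_mx (S *m B *m invmx S) =
    map_mx polyC S *m char_poly_mx B *m map_mx polyC (invmx S).
  rewrite /char_poly_mx !map_mxM mulmxBr mulmxBl; congr (_ - _).
  by rewrite scalar_mxC -mulmxA SV mulmx1.
by rewrite !det_mulmx mulrAC -det_mulmx SV det1 mul1r.
Qed.

Lemma trig_mxM (R : pzSemiRingType) (n : nat) (U V : 'M[R]_n) :
  is_trig_mx U -> is_trig_mx V ->
  is_trig_mx (U *m V) /\ forall i, (U *m V) i i = U i i * V i i.
Proof.
move=> /is_trig_mxP Ut /is_trig_mxP Vt; split=> [|i].
  apply/is_trig_mxP => i j ij; rewrite mxE big1 // => l _.
  by case: (ltnP i l) => il; [rewrite Ut ?mul0r | rewrite Vt ?mulr0 // (leq_ltn_trans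
    il)].
rewrite mxE (bigD1 i) //= big1 ?addr0 // => l li.
by case: (ltngtP i l) => il; [rewrite Ut ?mul0r | rewrite Vt ?mulr0 | case/eqP: li;
  apply: val_inj].
Qed.

Lemma trig_mxX (R : pzSemiRingType) (n k : nat) (U : 'M[R]_n) :
  is_trig_mx U -> is_trig_mx (U ^+ k) /\ forall i, (U ^+ k) i i = U i i ^+ k.
Proof.
move=> Ut; elim: k => [|k [IHt IHd]].
  by rewrite expr0; split=> [|i]; [exact: scalar_mx_is_trig | rewrite !mxE eqxx].
rewrite exprS; have [? Ud] := trig_mxM Ut IHt; split=> // i.
by rewrite exprS -IHd -Ud.
Qed.

Lemma minor_trig (R : idomainType) (n k : nat) (U : 'M[R]_n) (u : 'I_k -> 'I_n) :
  is_trig_mx U -> injective u -> minor U u u = \prod_i U (u i) (u i).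
Proof.
move=> /is_trig_mxP Ut uI; rewrite /minor /determinant (bigD1 1%g) //=.
rewrite odd_perm1 expr0 mul1r [X in _ + X]big1 ?addr0 => [|s s1].
  by apply: eq_bigr => i _; rewrite mxE perm1.
have [/existsP[i lti]|/existsPn le] := boolP [exists i, (u i < u (s i))%N].
  by rewrite (bigD1 i) //= mxE Ut // mul0r mulr0.
(* Here [u (s i) <= u i] for all [i]; both sides have the same sum, so equality holds termwise and
   [s] is the identity. *)
have := @leqif_sum _ predT (fun i => u (s i) == u i :> nat)
  (fun i => u (s i) : nat) (fun i => u i : nat).
case=> [i _|_]; first by apply/leqif_eq; rewrite leqNgt le.
rewrite [X in _ == X](reindex_perm s) /= eqxx => /esym/forallP us.
case/eqP: s1; apply/permP => i; rewrite perm1; apply: uI; apply: val_inj.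
exact/eqP/us.
Qed.

Lemma trig_similar (C : numClosedFieldType) (n : nat) (B : 'M[C]_n) (s : seq C) :
  char_poly B = \prod_(z <- s) ('X - z%:P) ->
  exists S U : 'M[C]_n, [/\ S \in unitmx, S *m B *m invmx S = U,
    is_trig_mx U & perm_eq s [seq U i i | i : 'I_n]].
Proof.
move=> Bs; pose diagp (U : 'M[C]_n) := perm_eq s [seq U i i | i : 'I_n].
suff [S Su Ut] : exists2 S, S \in unitmx & is_trig_mx (S *m B *m invmx S).
  exists S, (S *m B *m invmx S); split=> //; apply: perm_prod_XsubC.
  by rewrite -Bs -(char_poly_conj B Su) char_poly_trig // big_image.
case: n B {Bs diagp} => [|n] B.
  by exists 1%:M; rewrite ?unitmx1 //; apply/is_trig_mxP => -[].
have [//|S /unitarymx_unit Su] := Schur B.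
by rewrite /similar_to conjumx // => Ut; exists S.
Qed.

Lemma mxtrace_conjX (R : comUnitRingType) (n k : nat) (S B : 'M[R]_n) :
  S \in unitmx -> \tr ((S *m B *m invmx S) ^+ k) = \tr (B ^+ k).
Proof.
move=> Su; have -> : (S *m B *m invmx S) ^+ k = S *m B ^+ k *m invmx S.
  elim: k => [|k IHk]; first by rewrite !expr0 mulmx1 mulmxV.
  rewrite exprS IHk exprS.
  change (S *m B *m invmx S *m (S *m B ^+ k *m invmx S) =
    S *m (B *m B ^+ k) *m invmx S).
  by rewrite !mulmxA mulmxKV.
by rewrite mxtrace_mulC mulmxA mulVmx // mul1mx.
Qed.

Lemma mxtrace_char_poly (C : numClosedFieldType) (n k : nat) (B : 'M[C]_n)
    (s : seq C) :
  char_poly B = \prod_(z <- s) ('X - z%:P) -> \tr (B ^+ k) = \sum_(z <- s) z ^+ k.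
Proof.
move=> /trig_similar[S [U [Su BU Ut sU]]].
rewrite -(mxtrace_conjX k B Su) BU (perm_big _ sU) big_image /=.
by apply: eq_bigr => i _; rewrite (trig_mxX k Ut).2.
Qed.

Lemma minor_sum_char_poly (C : numClosedFieldType) (n k : nat) (B : 'M[C]_n)
    (s : seq C) :
  char_poly B = \prod_(z <- s) ('X - z%:P) ->
  minor_sum B k = (-1) ^+ k * k`!%:R * (\prod_(z <- s) (1 - z *: 'X))`_k.
Proof.
move=> /trig_similar[S [U [Su BU Ut sU]]].
transitivity (minor_sum U k).
  by rewrite -BU minor_sum_mulC mulmxA mulVmx // mul1mx.
rewrite (perm_big _ sU) big_image /= (coef_prod_1subZX k (fun i => U i i)).
rewrite mulrA [X in X * _]mulrAC -exprD -signr_odd oddD addbb expr0 mul1r.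
rewrite -(sum_image_inj_ffun _ (fun I => \prod_(i in I) U i i)).
rewrite /minor_sum (bigID (fun u : {ffun 'I_k -> 'I_n} => injectiveb u)) /=.
rewrite [X in _ + X]big1 ?addr0 => [|u /injectivePn[i [j ij uij]]]; last first.
  exact: minor_eq0 ij uij.
apply: eq_bigr => u /injectiveP uI; rewrite minor_trig // big_imset //=.
by move=> i j _ _; apply: uI.
Qed.

(** The bordered matrix [M] is made block triangular in two ways. The extra factor [a] avoids the
    exponent n - 1, and an integral domain is allowed because [a] is later 'X - 1. *)
Lemma det_scalar_const (R : idomainType) (n : nat) (a b : R) :
  a != 0 -> \det (a%:M + const_mx b : 'M[R]_n) * a = a ^+ n * (a + b *+ n).
Proof.
move=> a0; pose u : 'cV[R]_n := const_mx 1; pose v : 'rV[R]_n := const_mx b.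
have uv : u *m v = const_mx b.
  by apply/matrixP => i j; rewrite !mxE big_ord1 !mxE mul1r.
have vu : v *m u = (b *+ n)%:M.
  apply/matrixP => i j; rewrite !mxE !ord1 eqxx mulr1n.
  by under eq_bigr do rewrite !mxE mulr1; rewrite sumr_const card_ord.
pose M := block_mx (1%:M : 'M[R]_1) (- v) u (a%:M : 'M[R]_n).
have e1 : M *m block_mx 1%:M v 0 1%:M = block_mx 1%:M 0 u (a%:M + const_mx b).
  rewrite mulmx_block !mulmx1 !mul1mx !mulmx0 !addr0 uv subrr.
  by rewrite [const_mx b + _]addrC.
have e2 : M *m block_mx a%:M 0 (- u) 1%:M = block_mx (a + b *+ n)%:M (- v) 0 a%:M.
  rewrite mulmx_block !mulmx1 !mul1mx !mulmx0 !add0r mulNmx mulmxN opprK vu.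
  by rewrite -raddfD /= mulmxN mul_scalar_mx mul_mx_scalar subrr.
have := congr1 determinant e1; rewrite det_mulmx det_ublock det_lblock !det_scalar
  !expr1n !mulr1 mul1r.
move=> <-; have := congr1 determinant e2.
rewrite det_mulmx det_lblock det_ublock !det_scalar !expr1 expr1n mulr1 => ->.
by rewrite mulrC.
Qed.

(** * Schur orthogonality for exterior powers *)

Lemma card_permT (E : finType) : #|{perm E}| = (#|E|)`!.
Proof.
rewrite -cardsT -card_perm; apply: eq_card => s.
by rewrite inE; apply/esym/fintype.subsetP => x _; rewrite inE.
Qed.

Section Exterior.
Variables (R : realFieldType) (E : finType) (k : nat).
Implicit Types (f g h : {ffun 'I_k -> E}) (V : {ffun 'I_k -> E} -> R).

Definition ffun_perm f (s : 'S_k) : {ffun 'I_k -> E} := [ffun i => f (s i)].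

Definition ffun_act (t : {perm E}) f : {ffun 'I_k -> E} := [ffun i => t (f i)].

Definition ffun_upd f (i : 'I_k) (x : E) : {ffun 'I_k -> E} :=
  [ffun j => if j == i then x else f j].

(** Alternating functions form the exterior power of the permutation representation; [sums_to_zero]
    cuts out the exterior power of the standard one. *)
Definition alternating V := forall f s, V (ffun_perm f s) = (-1) ^+ s * V f.

Definition sums_to_zero V := forall f i, \sum_x V (ffun_upd f i x) = 0.

Lemma alternating_eq0 V f i j : alternating V -> i != j -> f i = f j -> V f = 0.
Proof.
move=> altV ij fij; have := altV f (tperm i j); rewrite odd_tperm ij expr1 mulN1r.
have -> : ffun_perm f (tperm i j) = f.
  by apply/ffunP => l; rewrite ffunE; case: tpermP => [->|->|].
by move/eqP; rewrite -subr_eq0 opprK -mulr2n mulrn_eq0 => /eqP.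
Qed.

Lemma exists_ffun_act f h : injective f -> injective h ->
  exists t : {perm E}, ffun_act t f = h.
Proof.
move=> fI hI.
suff /(_ k (leqnn k))[t tP] : forall m, (m <= k)%N ->
    exists t : {perm E}, forall i : 'I_k, (i < m)%N -> t (f i) = h i.
  by exists t; apply/ffunP => i; rewrite ffunE tP.
elim=> [|m IHm] mk; first by exists 1%g.
have [t tP] := IHm (ltnW mk); pose i0 := Ordinal mk.
exists (t * tperm (t (f i0)) (h i0))%g => i; rewrite ltnS leq_eqVlt permM => /orP[/eqP
  im|im].
  have -> : i = i0 by exact: val_inj.
  by rewrite tpermL.
have ii0 : i != i0 by rewrite -val_eqE neq_ltn im.
rewrite tpermD; first by rewrite tP.
- by rewrite (inj_eq perm_inj) (inj_eq fI) eq_sym.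
- by rewrite tP // (inj_eq hI) eq_sym.
Qed.

Definition invariant_kernel (G : {ffun 'I_k -> E} -> {ffun 'I_k -> E} -> R) :=
  [/\ forall t f g, G (ffun_act t f) (ffun_act t g) = G f g,
      forall g, alternating (G^~ g),
      forall f, alternating (G f)
    & forall f, sums_to_zero (G f)].

(** Schur's lemma in concrete form: an invariant kernel is determined by one diagonal value. The
    cases are the number of entries of [f] missing from [g]: with none, [g] reorders [f]; with two,
    a transposition reverses the sign; with one, the zero sum decides. *)
Lemma invariant_kernel_eq0 G h : (k < #|E|)%N -> invariant_kernel G ->
  injective h -> G h h = 0 -> forall f g, G f g = 0.
Proof.
move=> kE [Gact Galtl Galtr Gsum] hI Gh f g.
have [/injectiveP fI|/injectivePn[i [j ij fij]]] := boolP (injectiveb f); last first.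
  exact: (alternating_eq0 (Galtl g) ij fij).
have [/injectiveP gI|/injectivePn[i [j ij gij]]] := boolP (injectiveb g); last first.
  exact: (alternating_eq0 (Galtr f) ij gij).
have Gff : G f f = 0.
  by have [t <-] := exists_ffun_act hI fI; rewrite Gact.
have Gperm (s : 'S_k) g' : ffun_perm g s = g' -> G f g' = 0 -> G f g = 0.
  by move=> <-; rewrite Galtr => /eqP; rewrite mulf_eq0 signr_eq0 => /eqP.
(* The position in [g] of the entry [f j]; the default is read only when [f j] is missing from
   [g]. *)
pose p j := odflt j [pick l | g l == f j].
have pP j : f j \in codom g -> g (p j) = f j.
  move=> /codomP[l fl]; rewrite /p; case: pickP => [l' /eqP //|/(_ l)].
  by rewrite fl eqxx.
have [all_in|] := boolP [forall j, f j \in codom g].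
  have pI : injective p.
    by move=> i j /(congr1 g); rewrite !pP ?(forallP all_in) //; apply: fI.
  apply: (Gperm (perm pI) f) => //; apply/ffunP => j.
  by rewrite ffunE permE pP ?(forallP all_in).
move=> /forallPn[i0 fi0].
(* Swapping two entries of [f] that [g] does not contain fixes [g] and changes the sign of [f]. *)
have [/existsP[j /andP[ji0 fj]]|] := boolP [exists j, (j != i0) && (f j \notin codom g)].
  have := Gact (tperm (f j) (f i0)) f g.
  have -> : ffun_act (tperm (f j) (f i0)) g = g.
    apply/ffunP => l; rewrite ffunE tpermD //.
    - by apply: contraNneq fj => ->; apply: codom_f.
    - by apply: contraNneq fi0 => ->; apply: codom_f.
  have -> : ffun_act (tperm (f j) (f i0)) f = ffun_perm f (tperm j i0).
    apply/ffunP => l; rewrite !ffunE; case: (tpermP j i0 l) => [->|->|lj li].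
    - by rewrite tpermL.
    - by rewrite tpermR.
    - by rewrite tpermD // (inj_eq fI) eq_sym; apply/eqP.
  rewrite Galtl odd_tperm ji0 expr1 mulN1r => /eqP.
  by rewrite eq_sym -subr_eq0 opprK -mulr2n mulrn_eq0 => /eqP.
rewrite negb_exists => /forallP others.
have inP j : j != i0 -> f j \in codom g.
  by move=> ji; have := others j; rewrite ji negbK.
(* [x0] is the position of [g] left free by the other entries of [f]. Up to order, [g] is [f] with
   [f i0] replaced by [g x0]. *)
have [x0 x0P] : exists x0, x0 \notin [set p j | j in [set~ i0]]%SET.
  apply/existsP; rewrite -negb_forall; apply/negP => /forallP all_p.
  have : (#|'I_k| <= #|[set p j | j in [set~ i0]]%SET|)%N.
    by apply: subset_leq_card; apply/fintype.subsetP => x _; exact: all_p.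
  rewrite leqNgt => /negP; apply.
  by apply: (leq_ltn_trans (leq_imset_card _ _)); rewrite cardsC1 card_ord prednK //
    (leq_ltn_trans _ (ltn_ord i0)).
have x0p j : j != i0 -> x0 != p j.
  by move=> ji; apply: contraNneq x0P => ->; apply: imset_f; rewrite !inE.
pose q j := if j == i0 then x0 else p j.
have qI : injective q.
  move=> i j; rewrite /q; case: (eqVneq i i0) => [->|ii]; case: (eqVneq j i0) =>
    [->//|ji].
  - by move/eqP; rewrite (negbTE (x0p _ ji)).
  - by move/eqP; rewrite eq_sym (negbTE (x0p _ ii)).
  - by move/(congr1 g); rewrite !pP ?inP //; apply: fI.
pose b := g x0.
have bf j : b != f j.
  have [->|ji] := eqVneq j i0; first by apply: contraNneq fi0 => <-; apply: codom_f.
  by rewrite -pP ?inP // (inj_eq gI) x0p.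
apply: (Gperm (perm qI) (ffun_upd f i0 b)).
  by apply/ffunP => j; rewrite !ffunE permE /q; case: eqP => // /eqP ji; rewrite pP ?inP.
(* In this zero sum the values taken by [f] contribute nothing ([G f f] or a repeated entry). The
   remaining values exist since k < |E|, and all give the same term, because transposing two of them
   fixes [f]. *)
have := Gsum f f i0; rewrite (bigID (mem (codom f))) /= big1 ?add0r => [|x /codomP[j ->]].
  rewrite (eq_bigr (fun=> G f (ffun_upd f i0 b))) => [|x xf].
    rewrite sumr_const => /eqP; rewrite mulrn_eq0 => /orP[/eqP c0|/eqP //].
    have := cardC (mem (codom f)); rewrite c0 addn0 card_codom // card_ord.
    by move=> kE'; rewrite kE' ltnn in kE.
  have xfj j : x != f j by apply: contraNneq xf => ->; apply: codom_f.
  rewrite -[RHS](Gact (tperm b x)); congr (G _ _); apply/ffunP => j; rewrite !ffunE.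
    by rewrite tpermD ?bf ?xfj.
  by case: ifP => _; rewrite ?tpermL // tpermD ?bf ?xfj.
have [->|ji] := eqVneq j i0.
  suff -> : ffun_upd f i0 (f i0) = f by [].
  by apply/ffunP => l; rewrite ffunE; case: eqP => [->|].
by apply: (alternating_eq0 (Galtr f) ji); rewrite !ffunE eqxx (negbTE ji).
Qed.

End Exterior.

Lemma alternating_minor (R : realFieldType) (k : nat) (E U : finType) (K : U -> E -> R)
  (f : 'I_k -> U) :
  alternating (fun g : {ffun 'I_k -> E} => minor K f g).
Proof.
move=> g s; rewrite -minor_permr; congr (\det _).
by apply/matrixP => i j; rewrite !mxE ffunE.
Qed.

Lemma sums_to_zero_minor (R : realFieldType) (k : nat) (E U : finType) (K : U -> E -> R)
    (f : 'I_k -> U) :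
  (forall y, \sum_x K y x = 0) ->
  sums_to_zero (fun g : {ffun 'I_k -> E} => minor K f g).
Proof.
move=> K0 g i; rewrite /minor /determinant exchange_big big1 //= => s _.
rewrite -mulr_sumr; apply/eqP; rewrite mulf_eq0; apply/orP; right; apply/eqP.
pose j := (s^-1)%g i.
transitivity (\sum_x K (f j) x * \prod_(l | l != j) K (f l) (g (s l))).
  apply: eq_bigr => x _; rewrite (bigD1 j) //= mxE ffunE permKV eqxx.
  congr (_ * _); apply: eq_bigr => l lj; rewrite mxE ffunE.
  by rewrite -(inj_eq (@perm_inj _ s)) permKV in lj; rewrite (negbTE lj).
by rewrite -mulr_suml K0 mul0r.
Qed.

(** Kernel of the orthogonal projection onto functions of zero sum, that is, onto the standard
    representation. *)
Definition proj1C (R : realFieldType) (E : finType) (x y : E) : R :=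
  (x == y)%:R - #|E|%:R^-1.

Lemma sum_proj1C (R : realFieldType) (E : finType) (y : E) : \sum_x proj1C R y x = 0.
Proof.
rewrite /proj1C sumrB sumr_const -(mulr_natl _ #|_|) divff; last first.
  by rewrite pnatr_eq0 -lt0n; apply/card_gt0P; exists y.
rewrite (bigD1 y) //= eqxx big1 ?addr0 ?subrr // => x xy.
by rewrite eq_sym (negbTE xy).
Qed.

Lemma proj1CC (R : realFieldType) (E : finType) (x y : E) : proj1C R x y = proj1C R y x.
Proof. by rewrite /proj1C eq_sym. Qed.

Lemma proj1C_idem (R : realFieldType) (E : finType) (U : Type) (K : U -> E -> R) (z :
  U) (x : E) :
  (\sum_y K z y = 0) -> \sum_y K z y * proj1C R y x = K z x.
Proof.
move=> K0; under eq_bigr do rewrite mulrBr.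
rewrite sumrB -mulr_suml K0 mul0r subr0 (bigD1 x) //= eqxx mulr1 big1 ?addr0 // => y yx.
by rewrite (negbTE yx) mulr0.
Qed.

Lemma minor_proj1C_diag (R : realFieldType) (E : finType) (k : nat) (h : 'I_k -> E) :
  injective h -> minor (@proj1C R E) h h = 1 - k%:R / #|E|%:R.
Proof.
move=> hI; have := @det_scalar_const R k 1 (- #|E|%:R^-1) (oner_neq0 _).
rewrite expr1n mulr1 mul1r mulNrn -[#|E|%:R^-1 *+ k]mulr_natl => <-; congr (\det _).
by apply/matrixP => i j; rewrite !mxE /proj1C (inj_eq hI).
Qed.

(* Schur orthogonality in the k-th exterior power of the standard representation
   of the symmetric group: the averaged kernel is a multiple of the unique
   invariant one. *)
Lemma exterior_orthogonality (R : realFieldType) (E : finType) (k : nat)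
    (V W : {ffun 'I_k -> E} -> R) (f g : {ffun 'I_k -> E}) :
  (k < #|E|)%N -> alternating V -> alternating W -> sums_to_zero W ->
  (\sum_(t : {perm E}) V (ffun_act t f) * W (ffun_act t g)) * (#|E|.-1 ^_ k)%:R =
  (#|E|)`!%:R * (\sum_h V h * W h) * minor (@proj1C R E) f g.
Proof.
move=> kE altV altW sumW.
have actP t h (s : 'S_k) : ffun_act t (ffun_perm h s) = ffun_perm (ffun_act t h) s :>
  {ffun 'I_k -> E}.
  by apply/ffunP => i; rewrite !ffunE.
pose G f g : R := \sum_(t : {perm E}) V (ffun_act t f) * W (ffun_act t g).
pose D (f g : {ffun 'I_k -> E}) : R := minor (@proj1C R E) f g.
have Ginv : invariant_kernel G.
  split=> [t f' g'|g' f' s|f' g' s|f' g' i]; rewrite /G.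
  - rewrite [RHS](reindex_inj (mulgI t)); apply: eq_bigr => u _.
    by congr (V _ * W _); apply/ffunP => i; rewrite !ffunE permM.
  - by rewrite mulr_sumr; apply: eq_bigr => t _; rewrite actP altV mulrA.
  - by rewrite mulr_sumr; apply: eq_bigr => t _; rewrite actP altW mulrCA.
  - rewrite exchange_big big1 //= => t _; rewrite -mulr_sumr.
    rewrite (reindex_inj (@perm_inj _ (t^-1)%g)) /=.
    rewrite [X in _ * X](_ : _ = 0) ?mulr0 // -[RHS](sumW (ffun_act t g') i).
    apply: eq_bigr => x _; congr (W _); apply/ffunP => j; rewrite !ffunE.
    by case: ifP => // _; rewrite permKV.
have Dinv : invariant_kernel D.
  split=> [t f' g'|g' f' s|f' g' s|f' g' i]; rewrite /D.
  - congr (\det _); apply/matrixP => i j.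
    by rewrite !mxE !ffunE /proj1C (inj_eq perm_inj).
  - by rewrite minor_tr (alternating_minor (fun x y => proj1C R y x)) -minor_tr.
  - exact: alternating_minor.
  - by apply: sums_to_zero_minor => y; exact: sum_proj1C.
have E0 : #|E|%:R != 0 :> R by rewrite pnatr_eq0 -lt0n (leq_ltn_trans _ kE).
(* The combination [H] of two invariant kernels vanishes at [(h, h)], hence everywhere; the factor
   on the left is [D h h]. *)
have key (h : {ffun 'I_k -> E}) : injective h -> G f g * (1 - k%:R / #|E|%:R) = G h h *
  D f g.
  move=> hI; apply/eqP; rewrite -subr_eq0; apply/eqP.
  pose H (f g : {ffun 'I_k -> E}) := G f g * D h h - G h h * D f g.
  have Hinv : invariant_kernel H.
    have [G1 G2 G3 G4] := Ginv; have [D1 D2 D3 D4] := Dinv.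
    split=> [t f' g'|g' f' s|f' g' s|f' g' i]; rewrite /H.
    - by rewrite G1 D1.
    - by rewrite G2 D2 mulrBr !mulrA [G h h * _]mulrC.
    - by rewrite G3 D3 mulrBr !mulrA [G h h * _]mulrC.
    - by rewrite sumrB -mulr_suml -mulr_sumr G4 D4 mul0r mulr0 subrr.
  have := invariant_kernel_eq0 kE Hinv hI; rewrite /H subrr => /(_ erefl f g).
  by rewrite [D h h]minor_proj1C_diag.
(* Every permutation preserves the sum over the diagonal, so taking the trace removes the
   average. *)
have sumGh : \sum_(h : {ffun 'I_k -> E} | injectiveb h) G h h = (#|E|)`!%:R * \sum_h V
  h * W h.
  transitivity (\sum_(h : {ffun 'I_k -> E}) G h h).
    rewrite [RHS](bigID (fun h : {ffun 'I_k -> E} => injectiveb h)) /= [X in _ = _ +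
      X]big1 ?addr0 // => h.
    move=> /injectivePn[i [j ij hij]]; have [_ _ /(_ h) Galt _] := Ginv.
    exact: alternating_eq0 Galt ij hij.
  rewrite exchange_big /= (eq_bigr (fun=> \sum_h V h * W h)); last first.
    move=> t _; rewrite [RHS](reindex_inj (h := @ffun_act E k t)) // => h h' /ffunP hh.
    by apply/ffunP => i; have := hh i; rewrite !ffunE => /perm_inj.
  by rewrite sumr_const card_permT mulr_natl.
have sumkey : G f g * (1 - k%:R / #|E|%:R) * (#|E| ^_ k)%:R =
    (\sum_(h : {ffun 'I_k -> E} | injectiveb h) G h h) * D f g.
  rewrite [RHS]mulr_suml [RHS](eq_bigr (fun=> G f g * (1 - k%:R / #|E|%:R))); last first.
    by move=> h hI; rewrite -(key h) //; apply/injectiveP.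
  rewrite sumr_const mulr_natr; congr (_ *+ _).
  have := card_inj_ffuns 'I_k E; rewrite card_ord => <-.
  by apply: eq_card => h; rewrite inE.
rewrite -sumGh -sumkey -/(G f g) -mulrA; congr (_ * _).
(* The number of injective tuples times 1 - k/|E| is the falling factorial of |E| - 1, which is k!
   times the dimension of the representation. *)
case: #|E| kE E0 => [//|N] kN N0 /=.
rewrite ltnS in kN; apply: (mulfI N0); rewrite -natrM -ffactSS ffactnSr natrM natrB
  ?leqW //.
by field.
Qed.

(** Expand the square and apply orthogonality to each pair [f], [g]. Cauchy-Binet in [g] then
    absorbs the minor of the projection, since [K] already has zero row sums. *)
Lemma sum_sqr_minor_action (R : realFieldType) (E : finType) (k : nat) (K : E -> E -> R) :
  (k < #|E|)%N -> (forall y, \sum_x K x y = 0) -> (forall x, \sum_y K x y = 0) ->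
  (\sum_(t : {perm E}) (\sum_(f : {ffun 'I_k -> E}) minor K (ffun_act t f) f) ^+ 2) *
    (#|E|.-1 ^_ k)%:R =
  (#|E|)`!%:R * k`!%:R * \sum_(f : {ffun 'I_k -> E}) \sum_(g : {ffun 'I_k -> E}) minor
    K f g ^+ 2.
Proof.
move=> kE K0c K0r.
transitivity (\sum_(f : {ffun 'I_k -> E}) \sum_(g : {ffun 'I_k -> E})
   (\sum_(t : {perm E}) minor K (ffun_act t f) f * minor K (ffun_act t g) g) * (#|E|.-1
     ^_ k)%:R).
  under [RHS]eq_bigr do rewrite -mulr_suml.
  rewrite -mulr_suml; congr (_ * _).
  under [RHS]eq_bigr do rewrite exchange_big /=.
  rewrite exchange_big /=; apply: eq_bigr => t _; rewrite expr2 mulr_suml.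
  by apply: eq_bigr => f _; rewrite mulr_sumr.
transitivity (\sum_(f : {ffun 'I_k -> E}) \sum_(g : {ffun 'I_k -> E})
  (#|E|)`!%:R * (\sum_(h : {ffun 'I_k -> E}) minor K h f * minor K h g) * minor
    (@proj1C R E) g f).
  apply: eq_bigr => f _; apply: eq_bigr => g _.
  rewrite (exterior_orthogonality (V := fun h => minor K h f) (W := fun h => minor K h
    g)) //.
  - by congr (_ * _); rewrite minor_tr; congr (\det _); apply/matrixP => i j; rewrite
    !mxE proj1CC.
  - by move=> h s; rewrite minor_tr (alternating_minor (fun x y => K y x)) -minor_tr.
  - by move=> h s; rewrite minor_tr (alternating_minor (fun x y => K y x)) -minor_tr.
  - move=> h i; under eq_bigr do rewrite minor_tr.
    exact: (@sums_to_zero_minor _ _ _ _ (fun x y => K y x)).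
transitivity (\sum_(f : {ffun 'I_k -> E}) \sum_(h : {ffun 'I_k -> E}) (#|E|)`!%:R *
  minor K h f *
   \sum_(g : {ffun 'I_k -> E}) minor K h g * minor (@proj1C R E) g f).
  apply: eq_bigr => f _; under [RHS]eq_bigr do rewrite mulr_sumr.
  rewrite [RHS]exchange_big; apply: eq_bigr => g _ /=.
  by rewrite [X in X * _]mulr_sumr mulr_suml; apply: eq_bigr => h _; rewrite !mulrA.
rewrite exchange_big mulr_sumr; apply: eq_bigr => h _ /=.
rewrite mulr_sumr; apply: eq_bigr => f _.
rewrite (cauchy_binet K (@proj1C R E) h f).
have -> : minor (fun x z => \sum_y K x y * proj1C R y z) h f = minor K h f.
  by congr (\det _); apply/matrixP => i j; rewrite !mxE (proj1C_idem (K := K)).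
by ring.
Qed.

(** * Second moment of the coefficients *)

(* P - J/n, written as a sum over heads so that its minors expand over tuples of heads. *)
Definition centered_transition (R : realFieldType) (n d : nat) (sigma : matching n d) :
    'M[R]_n :=
  \matrix_(u, v)
    \sum_(e : half_edge n d) ((e.1 == u)%:R / d%:R) * proj1C R (sigma e).1 v.

Lemma card_half_edge (n d : nat) : #|half_edge n d| = (n * d)%N.
Proof. by rewrite card_prod !card_ord. Qed.

Lemma sum_half_edge_ffun (R : pzSemiRingType) (n d k : nat)
    (G : {ffun 'I_k -> 'I_n} -> R) :
  \sum_(f : {ffun 'I_k -> half_edge n d}) G [ffun i => (f i).1] =
  d%:R ^+ k * \sum_u G u.
Proof.
pose h (p : {ffun 'I_k -> 'I_n} * {ffun 'I_k -> 'I_d}) : {ffun 'I_k -> half_edge n d} :=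
  [ffun i => (p.1 i, p.2 i)].
rewrite (reindex h) /=; last first.
  exists (fun f => ([ffun i => (f i).1], [ffun i => (f i).2])) => [[u a]|f] _.
    by congr pair; apply/ffunP => i; rewrite !ffunE.
  by apply/ffunP => i; rewrite !ffunE /= -surjective_pairing.
rewrite mulr_sumr -(pair_bigA _ (fun u a => G [ffun i => (h (u, a) i).1])) /=.
apply: eq_bigr => u _; rewrite (eq_bigr (fun=> G u)) => [|a _]; last first.
  by congr G; apply/ffunP => i; rewrite !ffunE.
by rewrite sumr_const card_ffun !card_ord -natrX mulr_natl.
Qed.

Lemma sum_half_edge (R : pzSemiRingType) (n d : nat) (G : 'I_n -> R) :
  \sum_(e : half_edge n d) G e.1 = d%:R * \sum_u G u.
Proof.
rewrite mulr_sumr -(pair_bigA _ (fun u (a : 'I_d) => G u)) /=.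
by apply: eq_bigr => u _; rewrite sumr_const card_ord mulr_natl.
Qed.

(** The indicators in the rows force the vertex tuple to be the base of the head tuple. Afterwards
    [sigma] enters only through [ffun_act], the form to which orthogonality applies. *)
Lemma minor_sum_centered (R : realFieldType) (n d k : nat) (sigma : matching n d) :
  minor_sum (centered_transition R sigma) k = d%:R ^- k *
  \sum_(f : {ffun 'I_k -> half_edge n d})
    minor (fun e e' : half_edge n d => proj1C R e.1 e'.1) (ffun_act sigma f) f.
Proof.
transitivity (\sum_(u : {ffun 'I_k -> 'I_n}) \sum_(f : {ffun 'I_k -> half_edge n d})
    (\prod_i (((f i).1 == u i)%:R / d%:R)) *
    \det (\matrix_(i, j) proj1C R (sigma (f i)).1 (u j))).
  apply: eq_bigr => u _.
  apply: etrans (det_row_expand (fun i (e : half_edge n d) => (e.1 == u i)%:R / d%:R)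
    (fun e j => proj1C R (sigma e).1 (u j))).
  by congr (\det _); apply/matrixP => i j; rewrite !mxE.
rewrite exchange_big mulr_sumr; apply: eq_bigr => f _ /=.
rewrite (bigD1 [ffun i => (f i).1]) //= [X in _ + X]big1 ?addr0 => [|u uf]; last first.
  suff [i /negbTE fi] : exists i, (f i).1 != u i.
    by rewrite (bigD1 i) //= fi !mul0r.
  apply/existsP; rewrite -negb_forall; apply: contraNN uf => /forallP fu.
  by apply/eqP/ffunP => i; rewrite ffunE; apply/esym/eqP.
rewrite (eq_bigr (fun=> d%:R^-1)) => [|i _]; last by rewrite ffunE eqxx mul1r.
rewrite prodr_const card_ord exprVn; congr (_ * \det _).
by apply/matrixP => i j; rewrite !mxE !ffunE.
Qed.

(** The projection has rank n - 1, so its exterior power has trace C(n - 1, k); the tuples add the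
    factor k!. *)
Lemma sum_minor_proj1C (R : realFieldType) (n k : nat) :
  (0 < n)%N ->
  \sum_(u : {ffun 'I_k -> 'I_n}) minor (@proj1C R 'I_n) u u = (n.-1 ^_ k)%:R.
Proof.
move=> n0; rewrite (bigID (fun u : {ffun 'I_k -> 'I_n} => injectiveb u)) /=.
rewrite [X in _ + X]big1 ?addr0 => [|u /injectivePn[i [j ij uij]]]; last first.
  exact: minor_eq0 ij uij.
rewrite (eq_bigr (fun=> 1 - k%:R / n%:R)) => [|u /injectiveP uI]; last first.
  by rewrite minor_proj1C_diag // card_ord.
rewrite sumr_const.
have := card_inj_ffuns 'I_k 'I_n; rewrite !card_ord.
have -> : #|[set f : {ffun 'I_k -> 'I_n} | injectiveb f]%SET| =
  #|[pred f : {ffun 'I_k -> 'I_n} | injectiveb f]| by apply: eq_card => f; rewrite inE.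
move=> ->; rewrite -[_ *+ _]mulr_natl.
have nN0 : n%:R != 0 :> R by rewrite pnatr_eq0 -lt0n.
apply: (mulfI nN0); rewrite -[in RHS]natrM.
have -> : (n * n.-1 ^_ k = n ^_ k * (n - k))%N by case: (n) n0 => // m _; rewrite
  -ffactSS ffactnSr.
have [nk|kn] := ltnP n k; first by rewrite ffact_small // mul0n !mul0r mulr0.
by rewrite natrM natrB //; field.
Qed.

Lemma ffact_scale (n d k : nat) : (0 < n)%N -> (0 < d)%N ->
  (n.-1 ^_ k * d ^ k <= (n * d).-1 ^_ k)%N.
Proof.
move=> n0 d0; elim: k => [|k IHk]; first by rewrite !ffactn0 expn0.
rewrite !ffactnSr expnSr mulnACA leq_mul //.
have [nk|kn] := leqP n.-1 k; first by rewrite (eqP (_ : n.-1 - k == 0)%N) // subn_eq0.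
rewrite mulnBl.
have : (k <= k * d)%N by rewrite leq_pmulr.
have : (n.-1 * d + d = n * d)%N by rewrite -mulSnr prednK.
lia.
Qed.

(** The average is exactly k!^2 C(n - 1, k) / C(nd - 1, k), a ratio of dimensions for vertices and
    for half-edges; [ffact_scale] bounds this ratio by d^(-k). *)
Lemma second_moment_minor_sum (R : realFieldType) (n d k : nat) :
  (0 < n)%N -> (0 < d)%N -> (k < n * d)%N ->
  \sum_(sigma : matching n d) minor_sum (centered_transition R sigma) k ^+ 2 <=
  (n * d)`!%:R * k`!%:R ^+ 2 * d%:R ^- k.
Proof.
move=> n0 d0 knd.
have dN0 : d%:R != 0 :> R by rewrite pnatr_eq0 -lt0n.
pose K (e e' : half_edge n d) : R := proj1C R e.1 e'.1.
under eq_bigr do rewrite minor_sum_centered exprMn.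
rewrite -mulr_sumr.
have K0 (x : 'I_n) : \sum_(e : half_edge n d) proj1C R x e.1 = 0.
  by rewrite (sum_half_edge d (proj1C R x)) sum_proj1C mulr0.
have K0' (x : 'I_n) : \sum_(e : half_edge n d) proj1C R e.1 x = 0.
  by under eq_bigr do rewrite proj1CC.
have := @sum_sqr_minor_action R (half_edge n d) k K.
rewrite card_half_edge => /(_ knd) /(_ (fun y => K0' y.1)) /(_ (fun x => K0 x.1)).
(* A sum over half-edges is [d] times a sum over vertices and the projection is idempotent, so [K]
   composed with itself is [d] times [K]. *)
have -> : \sum_(f : {ffun 'I_k -> half_edge n d}) \sum_(g : {ffun 'I_k -> half_edge n d})
    minor K f g ^+ 2 = k`!%:R * d%:R ^+ k * d%:R ^+ k * (n.-1 ^_ k)%:R.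
  transitivity (\sum_(f : {ffun 'I_k -> half_edge n d}) k`!%:R * d%:R ^+ k *
      minor (@proj1C R 'I_n) [ffun i => (f i).1] [ffun i => (f i).1]).
    apply: eq_bigr => f _.
    transitivity (\sum_(g : {ffun 'I_k -> half_edge n d}) minor K f g * minor K g f).
      apply: eq_bigr => g _; rewrite expr2; congr (_ * _); rewrite minor_tr.
      by congr (\det _); apply/matrixP => i j; rewrite !mxE /K proj1CC.
    rewrite cauchy_binet -mulrA; congr (_ * _).
    rewrite /minor -detZ; congr (\det _); apply/matrixP => i j.
    rewrite !mxE !ffunE /K.
    rewrite (sum_half_edge d (fun v => proj1C R (f i).1 v * proj1C R v (f j).1)).
    by rewrite proj1C_idem // sum_proj1C.
  rewrite -mulr_sumr (sum_half_edge_ffun d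
    (fun u : {ffun 'I_k -> 'I_n} => minor (@proj1C R 'I_n) u u)).
  by rewrite sum_minor_proj1C // !mulrA.
set S := \sum_(t : {perm half_edge n d}) _ => eS.
have c0 : 0 < ((n * d).-1 ^_ k)%:R :> R.
  by rewrite ltr0n ffact_gt0 -ltnS prednK // muln_gt0 n0 d0.
rewrite -(ler_pM2r c0) -[d%:R ^- k ^+ 2 * S * _]mulrA eS.
have -> : d%:R ^- k ^+ 2 * ((n * d)`!%:R * k`!%:R *
    (k`!%:R * d%:R ^+ k * d%:R ^+ k * (n.-1 ^_ k)%:R)) =
  (n * d)`!%:R * k`!%:R ^+ 2 * (n.-1 ^_ k)%:R :> R.
  by field; rewrite expf_neq0.
rewrite -!mulrA ler_wpM2l ?ler0n // ler_wpM2l ?exprn_ge0 ?ler0n //.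
rewrite ler_wpM2l ?ler0n // [leRHS]mulrC ler_pdivlMr ?exprn_gt0 ?ltr0n //.
by rewrite -natrX -natrM ler_nat ffact_scale.
Qed.

(** * Closed walks *)

Lemma rot_behead (T : Type) (x : T) (s : seq T) (i : nat) :
  (i < size s)%N -> rot i s = nth x s i :: behead (rot i s).
Proof. by move=> si; rewrite /rot (drop_nth x). Qed.

Section FunctionalWalks.
Variables (T V : eqType) (v w : T -> V).
Implicit Types (s : seq T).

(** Walks are sequences of heads: [v] gives the vertex carrying a head, [w] the vertex at which it
    lands. *)
Definition walk_step : rel T := fun x y => w x == v y.

(* No two different elements of [s] have the same [v]: a walk with this property
   is determined by its starting point. *)
Definition consistent s : bool := all (fun x => all (fun y => (v x == v y) ==> (x ==
  y)) s) s.

Lemma consistentP s :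
  reflect {in s &, injective v} (consistent s).
Proof.
apply: (iffP allP) => [cs x y xs ys /eqP vxy|vI x xs].
  by have /allP/(_ y ys)/implyP/(_ vxy)/eqP := cs x xs.
by apply/allP => y ys; apply/implyP => /eqP/vI->.
Qed.

Lemma walk_step_det a s s' : consistent (s ++ s') -> size s = size s' ->
  path walk_step a s -> path walk_step a s' -> s = s'.
Proof.
elim: s s' a => [|b s IHs] [|b' s'] a //= /consistentP cs [ss] /andP[ab bs] /andP[ab'
  bs'].
have bb' : b = b'.
  apply: cs; rewrite ?mem_head //; last by rewrite -(eqP ab) -(eqP ab').
  by rewrite inE mem_cat mem_head !orbT.
rewrite -bb' in bs' cs *; congr cons; apply: (IHs s' b) => //.
apply/consistentP => x y; rewrite !mem_cat => xs ys; apply: cs; rewrite inE mem_cat inE.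
  by case/orP: xs => ->; rewrite !orbT.
by case/orP: ys => ->; rewrite !orbT.
Qed.

(** A return to a vertex is a return to the same head, and from there the walk must repeat
    itself. *)
Lemma closed_walk_period s x0 i j : path.cycle walk_step s -> consistent s ->
  (i < j < size s)%N -> v (nth x0 s i) = v (nth x0 s j) -> rot (j - i) s = s.
Proof.
move=> cyc cons_s /andP[ij js] vij; have is' := ltn_trans ij js.
have eij : nth x0 s i = nth x0 s j by move/consistentP: cons_s; apply; rewrite ?mem_nth.
suff : rot (j - i) (rot i s) = rot i s.
  by rewrite rot_rot => /rot_inj.
have c1 : path.cycle walk_step (rot i s) by rewrite rot_cycle.
have c2 : path.cycle walk_step (rot (j - i) (rot i s)) by rewrite rot_cycle.
have h1 : rot i s = nth x0 s i :: behead (rot i s).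
  exact: rot_behead.
have jis : (j - i < size (rot i s))%N by rewrite size_rot (leq_ltn_trans (leq_subr _ _)).
have h2 : rot (j - i) (rot i s) = nth x0 s i :: behead (rot (j - i) (rot i s)).
  rewrite {1}(rot_behead x0 jis); congr (_ :: _).
  by rewrite /rot nth_cat size_drop ltn_sub2r // nth_drop subnKC ?eij // ltnW.
rewrite [LHS]h2 [RHS]h1; congr (_ :: _); symmetry.
apply: (@walk_step_det (nth x0 s i)).
- apply/consistentP => x y; rewrite !mem_cat => xs ys; move/consistentP: cons_s; apply.
    by case/orP: xs => /mem_behead; rewrite !mem_rot.
  by case/orP: ys => /mem_behead; rewrite !mem_rot.
- by rewrite !size_behead !size_rot.
- by move: c1; rewrite h1 /= rcons_path => /andP[].
- by move: c2; rewrite h2 /= rcons_path => /andP[].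
Qed.

(** Take the least rotation fixing [s]. A repeated vertex inside one period would produce a smaller
    one. *)
Lemma closed_walk_simple_or_periodic s : path.cycle walk_step s -> consistent s ->
  ~~ uniq (map v s) ->
  exists l, [/\ (0 < l <= (size s)./2)%N, rot l s = s,
    path.cycle walk_step (take l s) & uniq (map v (take l s))].
Proof.
move=> cyc cons_s; case: s cyc cons_s => [//|a0 s0].
set s := a0 :: s0 => cyc cons_s Nuniq.
have exl : exists l, (0 < l)%N && (rot l s == s).
  by exists (size s); rewrite rot_size eqxx.
have [l /andP[l0 /eqP ls] lmin] := ex_minnP exl.
have period i j : (i < j < size s)%N -> v (nth a0 s i) = v (nth a0 s j) -> (l <= j - i)%N.
  move=> ijs vij; apply: lmin; rewrite subn_gt0 (andP ijs).1 /=.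
  exact/eqP/(closed_walk_period cyc cons_s ijs vij).
have lts : (l < size s)%N.
  have /(uniqPn (v a0))[i [j [ij]]] := Nuniq.
  rewrite size_map => js; rewrite !(nth_map a0) // ?(ltn_trans ij) // => vij.
  by apply: (leq_ltn_trans (period i j _ vij)); rewrite ?ij ?js // (leq_ltn_trans
    (leq_subr _ _)).
(* The inverse rotation by [size s - l] fixes [s] too, so minimality gives [l <= size s - l]. *)
have lhalf : (l <= (size s)./2)%N.
  have : (l <= size s - l)%N.
    apply: lmin; rewrite subn_gt0 lts /=; apply/eqP.
    by rewrite -/(rotr l s) -{1}ls rotK.
  by move=> ?; lia.
exists l; split=> //; first by rewrite l0.
  have sE : s = take l s ++ a0 :: behead (drop l s).
    rewrite -[LHS](cat_take_drop l); congr (_ ++ _).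
    have : drop l s = nth a0 s l :: behead (drop l s) by rewrite (drop_nth a0).
    suff -> : nth a0 s l = a0 by [].
    rewrite -[RHS]/(nth a0 s 0) -[in RHS]ls /rot nth_cat size_drop subn_gt0 lts.
    by rewrite nth_drop addn0.
  have tE : take l s = a0 :: behead (take l s) by case: (l) l0.
  move: cyc; rewrite {1}sE tE /= !rcons_path cat_path /=.
  by move=> /andP[/and3P[-> ->]].
apply/negPn/negP => /(uniqPn (v a0))[i [j [ij]]].
rewrite size_map size_takel ?(ltnW lts) // => jl.
rewrite !(nth_map a0) ?size_takel ?(ltnW lts) ?(ltn_trans ij) // !nth_take ?(ltn_trans
  ij) //.
move=> vij; have := period i j; rewrite ij (ltn_trans jl lts) => /(_ isT vij).
by rewrite leqNgt (leq_ltn_trans (leq_subr _ _)).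
Qed.

Lemma periodic_inj l s s' : (0 < l)%N -> rot l s = s -> rot l s' = s' ->
  size s = size s' -> (l <= size s)%N -> take l s = take l s' -> s = s'.
Proof.
move=> l0 ls ls' ss lsz tt; case: s ls ss lsz tt => [|x0 s0]; first by case: s' ls'.
set s := x0 :: s0 => ls ss lsz tt.
have shift (u : seq T) i : rot l u = u -> (l <= i < size u)%N -> nth x0 u i = nth x0 u
  (i - l).
  move=> lu /andP[li iu]; rewrite -[in RHS]lu /rot nth_cat size_drop ltn_sub2r
    ?(leq_ltn_trans li) //.
  by rewrite nth_drop subnKC.
apply: (@eq_from_nth _ x0) => // i; elim/ltn_ind: i => i IHi ilt.
have [il|li] := ltnP i l.
  by rewrite -(nth_take x0 il) tt nth_take.
rewrite (shift s) ?li // (shift s') ?li -?ss //; apply: IHi.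
  by rewrite ltn_subrL l0 (leq_trans l0 li).
by rewrite (leq_ltn_trans (leq_subr _ _)).
Qed.

Lemma path_walk_step a s : path walk_step a s = (map w (belast a s) == map v s).
Proof. by elim: s a => [|b s IHs] a //=; rewrite IHs eqseq_cons. Qed.

Lemma cycle_walk_step s : path.cycle walk_step s = (map w s == map v (rot 1 s)).
Proof. by case: s => [|a s] //=; rewrite path_walk_step belast_rcons rot1_cons. Qed.

(** Two closed walks through a common vertex, rotated to start there, join into one closed walk of
    double length. If it is consistent, both halves are the same deterministic orbit. *)
Lemma merged_closed_walks s s' x y i j : path.cycle walk_step s -> path.cycle walk_step
  s' ->
  (i < size s)%N -> (j < size s')%N -> size s = size s' -> v (nth x s i) = v (nth y s'
    j) ->
  path.cycle walk_step (rot i s ++ rot j s') /\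
  (consistent (rot i s ++ rot j s') -> rot i s = rot j s').
Proof.
move=> cs cs' is' js' ss vij.
have c1 : path.cycle walk_step (rot i s) by rewrite rot_cycle.
have c2 : path.cycle walk_step (rot j s') by rewrite rot_cycle.
have h1 : rot i s = nth x s i :: behead (rot i s) by exact: rot_behead.
have h2 : rot j s' = nth y s' j :: behead (rot j s') by exact: rot_behead.
have sz : size (behead (rot i s)) = size (behead (rot j s')).
  by rewrite !size_behead !size_rot ss.
rewrite h1 h2 in c1 c2 *; move: (behead (rot i s)) (behead (rot j s')) sz c1 c2.
move: (nth x s i) (nth y s' j) vij => a b vab u u' uu'.
rewrite /= !rcons_path => /andP[au la] /andP[bu lb]; split.
  rewrite cat_path au /= last_cat /= bu /walk_step vab -/(walk_step _ _) /=.
  by move: la lb; rewrite /walk_step vab => -> ->.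
move=> /consistentP cons_s.
have ab : a = b by apply: cons_s; rewrite ?mem_head // inE mem_cat mem_head !orbT.
rewrite -ab in bu *; congr (_ :: _); apply: (walk_step_det _ uu' au bu).
apply/consistentP => z t; rewrite !mem_cat => zu tu; apply: cons_s; rewrite inE mem_cat
  inE.
  by case/orP: zu => ->; rewrite ?orbT.
by case/orP: tu => ->; rewrite ?orbT.
Qed.

End FunctionalWalks.

(** * Counting matchings and walks through tuples of heads *)

Lemma sum_tuple_cons (R : nmodType) (T : finType) (k : nat) (F : seq T -> R) :
  \sum_(t : k.+1.-tuple T) F t = \sum_x \sum_(t : k.-tuple T) F (x :: t).
Proof.
rewrite (reindex (fun p : T * k.-tuple T => cons_tuple p.1 p.2)) /=; last first.
  exists (fun t : k.+1.-tuple T => (thead t, behead_tuple t)) => [[x t]|t] _.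
    by congr pair; apply/val_inj.
  by apply/val_inj; rewrite /= -[in RHS](cat_take_drop 1 t); case/tupleP: t => x t /=;
    rewrite take0 drop0.
by rewrite -(pair_bigA _ (fun x t => F (x :: val t))).
Qed.

Lemma sum_tuple0 (R : nmodType) (T : finType) (F : seq T -> R) :
  \sum_(t : 0.-tuple T) F t = F [::].
Proof.
rewrite (big_pred1 [tuple]) // => t; apply/esym/eqP/val_inj.
by rewrite /= (size0nil (size_tuple t)).
Qed.

Lemma sum_tuple_cat (R : nmodType) (T : finType) (k l : nat) (F : seq T -> R) :
  \sum_(t : (k + l).-tuple T) F t =
  \sum_(t : k.-tuple T) \sum_(u : l.-tuple T) F (t ++ u).
Proof.
elim: k F => [|k IHk] F.
  by rewrite (sum_tuple0 (fun s => \sum_(u : l.-tuple T) F (s ++ u))).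
rewrite addSn (sum_tuple_cons (k + l)).
rewrite (sum_tuple_cons _ (fun s => \sum_(u : l.-tuple T) F (s ++ u))).
by apply: eq_bigr => x _; rewrite (IHk (fun s => F (x :: s))).
Qed.

Lemma sum_tuple_half_edge (n d k : nat) (G : seq 'I_n -> nat) :
  (\sum_(t : k.-tuple (half_edge n d)) G (map fst t) =
  d ^ k * \sum_(u : k.-tuple 'I_n) G u)%N.
Proof.
elim: k G => [|k IHk] G.
  by rewrite expn0 mul1n (sum_tuple0 (fun s => G (map fst s))) sum_tuple0.
rewrite (sum_tuple_cons _ (fun s => G (map fst s))) (sum_tuple_cons _ G) /=.
under eq_bigr do rewrite (IHk (fun s => G (_ :: s))).
rewrite -(pair_bigA _ (fun u (a : 'I_d) => d ^ k * \sum_(t : k.-tuple 'I_n) G (u ::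
  t))%N) /=.
rewrite big_distrr /=; apply: eq_bigr => u _.
by rewrite sum_nat_const card_ord mulnA expnS.
Qed.

(** Induction on the number of prescribed images. The count for one more image [z] is zero if [z]
    lies in [y] and otherwise independent of [z], by composing with a transposition. *)
Lemma count_perm_map (E : finType) (x y : seq E) :
  uniq x -> uniq y -> size x = size y ->
  (\sum_(s : {perm E}) (map s x == y) = (#|E| - size x)`!)%N.
Proof.
elim: x y => [|a x IHx] [|b y] //=.
  by move=> *; rewrite subn0 sum1_card card_permT.
move=> /andP[ax xU] /andP[bY yU] [xy].
pose c z := (\sum_(s : {perm E}) ((map s x == y) && (s a == z)))%N.
have cb z : z \notin y -> c z = c b.
  move=> zy; rewrite /c (reindex_inj (mulIg (tperm b z))) /=.
  apply: eq_bigr => s _; rewrite permM.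
  rewrite (_ : (tperm b z (s a) == z) = (s a == b)); last first.
    by rewrite -(inj_eq (@perm_inj _ (tperm b z)) (s a)) tpermL.
  congr (nat_of_bool (_ && _)).
  rewrite (eq_map (g := tperm b z \o s)); last by move=> i; rewrite permM.
  rewrite map_comp.
  have {1}<- : map (tperm b z) y = y.
    rewrite -[RHS]map_id; apply/eq_in_map => i iy; rewrite tpermD //.
      by apply: contraNneq bY => ->.
    by apply: contraNneq zy => ->.
  by rewrite (inj_eq (inj_map perm_inj)).
have c0 z : z \in y -> c z = 0%N.
  move=> zy; rewrite /c big1 // => s _; case: eqP => //= sxy; case: eqP => //= saz.
  by move: zy; rewrite -sxy -saz (mem_map perm_inj) (negbTE ax).
have sumc : (\sum_z c z = (#|E| - size x)`!)%N.
  rewrite -(IHx y) // exchange_big /=; apply: eq_bigr => s _.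
  rewrite (bigD1 (s a)) //= eqxx andbT big1 ?addn0 // => z zs.
  by rewrite [s a == z]eq_sym (negbTE zs) andbF.
have cardE : (\sum_(z | z \notin y) 1 = #|E| - size x)%N.
  rewrite sum1_card -(cardC (mem y)) (card_uniqP yU) xy addKn.
  by apply: eq_card => z; rewrite !inE.
have /card_uniqP byU : uniq (b :: y) by rewrite /= bY.
have xE : (size x < #|E|)%N by rewrite xy -[(size y).+1]/(size (b :: y)) -byU max_card.
transitivity (c b); first by apply: eq_bigr => s _; rewrite eqseq_cons andbC.
apply/eqP; rewrite -(eqn_pmul2l (m := #|E| - size x)) ?subn_gt0 //.
have -> : (#|E| - (size x).+1 = (#|E| - size x).-1)%N by lia.
have -> : ((#|E| - size x) * ((#|E| - size x).-1)`! = (#|E| - size x)`!)%N.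
  by move: xE; rewrite -subn_gt0; case: (#|E| - size x)%N => // m _; rewrite factS.
rewrite -sumc (bigID (mem y)) /= big1 => [|z /c0 //].
rewrite add0n -cardE big_distrl /=; apply/eqP; apply: eq_bigr => z /cb ->.
by rewrite mul1n.
Qed.

Lemma sum_tuple_eq_map (n d : nat) (ws : seq 'I_n) k : size ws = k ->
  (\sum_(t : k.-tuple (half_edge n d)) (map fst t == ws) = d ^ k)%N.
Proof.
move=> <-; rewrite (sum_tuple_half_edge d _ (fun s => (s == ws) : nat)).
rewrite (bigD1 (in_tuple ws)) //= eqxx big1 ?addn0 ?muln1 // => t tw.
by rewrite (_ : (val t == ws) = false) //; apply: contraNF tw => /eqP tw;
  apply/eqP/val_inj.
Qed.

Section MatchingCount.
Variables (n d : nat).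
Let N := (n * d)%N.
Implicit Types (sigma : matching n d) (x : seq (half_edge n d)).

Lemma split_count (x : seq (half_edge n d)) (ws : seq 'I_n) :
  (\sum_(sigma : matching n d) (map (fun e => (sigma e).1) x == ws) =
   \sum_(y : (size x).-tuple (half_edge n d)) (map fst y == ws) *
      \sum_(sigma : matching n d) (map sigma x == y))%N.
Proof.
under [RHS]eq_bigr do rewrite big_distrr /=.
rewrite [RHS]exchange_big /=; apply: eq_bigr => sigma _.
rewrite (bigD1 (map_tuple sigma (in_tuple x))) //= eqxx muln1 -map_comp.
rewrite big1 ?addn0 // => y /eqP yx.
rewrite (_ : (map sigma x == y) = false) ?muln0 //.
by apply/negP => /eqP e; apply: yx; apply/val_inj; rewrite /= e.
Qed.

Lemma count_matching_le (x : seq (half_edge n d)) (ws : seq 'I_n) :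
  uniq x ->
  (\sum_(sigma : matching n d) (map (fun e => (sigma e).1) x == ws) <=
   d ^ size x * (N - size x)`!)%N.
Proof.
move=> xU; have [sw|/eqP sw] := eqVneq (size ws) (size x); last first.
  rewrite big1 // => sigma _; case: eqP => // e; case: sw.
  by rewrite -e size_map.
rewrite split_count -(sum_tuple_eq_map d sw) big_distrl /=; apply: leq_sum => y _.
rewrite leq_mul2l; apply/orP; right.
have [yU|/negP yU] := boolP (uniq y).
  by rewrite count_perm_map ?size_tuple // card_half_edge.
rewrite big1 // => sigma _; case: eqP => // e; case: yU.
by rewrite -e (map_inj_uniq perm_inj).
Qed.

(** Distinct target vertices force distinct tails, so none of the d^k choices of tails is lost and
    the upper bound is attained. *)
Lemma count_matching_uniq (x : seq (half_edge n d)) (ws : seq 'I_n) :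
  uniq x -> uniq ws -> size ws = size x ->
  (\sum_(sigma : matching n d) (map (fun e => (sigma e).1) x == ws) =
   d ^ size x * (N - size x)`!)%N.
Proof.
move=> xU wU sw; rewrite split_count -(sum_tuple_eq_map d sw) big_distrl /=.
apply: eq_bigr => y _; case: eqP => [yw|_]; last by rewrite !mul0n.
rewrite count_perm_map ?size_tuple // ?card_half_edge //.
by apply: (@map_uniq _ _ fst); rewrite yw.
Qed.

End MatchingCount.

Lemma sum_bool_le1 (T : finType) (P : pred T) :
  (forall x y, P x -> P y -> x = y) -> (\sum_x (P x : nat) <= 1)%N.
Proof.
move=> PI; case: (pickP P) => [x0 Px0|P0]; last by rewrite big1 // => x _; rewrite P0.
rewrite (bigD1 x0) //= Px0 big1 // => x xx0.
by case: (boolP (P x)) => // Px; rewrite (PI x x0) ?eqxx in xx0.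
Qed.

Section WalkCounts.
Variables (n d : nat).
Local Notation E := (half_edge n d).
Implicit Types (sigma : matching n d) (s t u : seq E) (k l : nat).

Definition closed_walk sigma s : bool :=
  path.cycle (walk_step fst (fun e => (sigma e).1)) s.

Definition simple_walk sigma s : bool := closed_walk sigma s && uniq (map fst s).

Definition tangled_walk sigma s : bool := closed_walk sigma s && ~~ consistent fst s.

Definition nb_walks sigma k : nat := \sum_(t : k.-tuple E) closed_walk sigma t.

(** The starting head is part of a walk, so a cycle of length k is counted k times and the mean is
    near d^k. *)
Definition nb_simple sigma k : nat := \sum_(t : k.-tuple E) simple_walk sigma t.

Definition nb_tangled sigma k : nat := \sum_(t : k.-tuple E) tangled_walk sigma t.

Definition nb_disjoint sigma k : nat :=
  \sum_(t : k.-tuple E) \sum_(u : k.-tuple E)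
    [&& closed_walk sigma t, closed_walk sigma u & uniq (map fst (t ++ u))].

Lemma nb_simple_le sigma k : (nb_simple sigma k <= nb_walks sigma k)%N.
Proof. by apply: leq_sum => t _; rewrite /simple_walk; case: closed_walk => //=; case:
  uniq. Qed.

Lemma nb_periodic_le k l (Q : pred (seq E)) : (0 < l <= k)%N ->
  (\sum_(t : k.-tuple E) ((rot l t == t) && Q (take l t)) <=
   \sum_(g : l.-tuple E) Q g)%N.
Proof.
move=> /andP[l0 lk].
apply: (@leq_trans (\sum_(t : k.-tuple E) \sum_(g : l.-tuple E)
    ((rot l t == t) && (take l t == g)) * Q g)%N).
  apply: leq_sum => t _; case: eqP => //= tt.
  have sz : size (take l t) == l by rewrite size_takel ?size_tuple.
  by rewrite (bigD1 (Tuple sz)) //= eqxx mul1n leq_addr.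
rewrite exchange_big /=; apply: leq_sum => g _.
rewrite -big_distrl /= -[leqRHS]mul1n leq_mul2r; apply/orP; right.
apply: sum_bool_le1 => t t' /andP[/eqP tt /eqP tg] /andP[/eqP tt' /eqP tg'].
by apply/val_inj/(periodic_inj l0 tt tt'); rewrite ?size_tuple // tg tg'.
Qed.

(** An untangled closed walk is simple or determined by a simple one of length l <= k/2. Summing
    over all such l, divisors of k or not, still costs only the order of d^(k/2). *)
Lemma nb_walks_le sigma k :
  (nb_walks sigma k <= nb_simple sigma k +
     \sum_(1 <= l < k./2.+1) nb_simple sigma l + nb_tangled sigma k)%N.
Proof.
pose per t := [&& closed_walk sigma t, consistent fst t & ~~ uniq (map fst t)].
apply: (@leq_trans (nb_simple sigma k + \sum_(t : k.-tuple E) per t + nb_tangled sigma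
  k)%N).
  rewrite /nb_simple /nb_tangled -!big_split /=; apply: leq_sum => t _.
  rewrite /per /simple_walk /tangled_walk.
  by case: closed_walk => //=; case: consistent => //=; case: uniq.
rewrite leq_add2r leq_add2l.
apply: (@leq_trans (\sum_(1 <= l < k./2.+1) \sum_(t : k.-tuple E)
    ((rot l t == t) && simple_walk sigma (take l t)))%N).
  rewrite exchange_big /=; apply: leq_sum => t _.
  case: (boolP (per t)) => // /and3P[ct const Nt].
  have [l [lk lt cl ul]] := closed_walk_simple_or_periodic ct const Nt.
  rewrite size_tuple in lk.
  rewrite (big_rem l) ?mem_index_iota ?ltnS //=.
  by rewrite lt eqxx /simple_walk /closed_walk cl ul.
rewrite big_nat_cond [leqRHS]big_nat_cond; apply: leq_sum => l /andP[/andP[l1 lk] _].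
by apply: (@nb_periodic_le k l (simple_walk sigma)); lia.
Qed.

Lemma sum_tuple_rot (R : nmodType) (T : finType) (k i : nat) (F : seq T -> R) :
  \sum_(t : k.-tuple T) F (rot i t) = \sum_(t : k.-tuple T) F t.
Proof.
rewrite [RHS](reindex_inj (h := fun t : k.-tuple T => [tuple of rot i t])) //.
by move=> t t' /(congr1 val) /= /rot_inj/val_inj.
Qed.

(** Two simple walks are disjoint or can be rotated to a common vertex, in at most k^2 ways. Then
    either they coincide or their concatenation is a tangled walk of length 2k. *)
Lemma nb_simple_sqr sigma k :
  (nb_simple sigma k ^ 2 <= nb_disjoint sigma k +
     k ^ 2 * (nb_simple sigma k + nb_tangled sigma (k + k)))%N.
Proof.
pose near (t u : k.-tuple E) := (\sum_(i < k) \sum_(j < k)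
  (simple_walk sigma t * (rot i t == rot j u) + tangled_walk sigma (rot i t ++ rot j
    u)))%N.
apply: (@leq_trans (nb_disjoint sigma k + \sum_(t : k.-tuple E) \sum_(u : k.-tuple E)
  near t u)%N).
  rewrite /nb_simple expnS expn1 big_distrl -big_split /=; apply: leq_sum => t _.
  rewrite big_distrr -big_split /=; apply: leq_sum => u _.
  have [tS|] := boolP (simple_walk sigma t); last by rewrite mul0n.
  have [uS|] := boolP (simple_walk sigma u); last by rewrite muln0.
  have /andP[ct tU] := tS; have /andP[cu uU] := uS.
  rewrite ct cu map_cat cat_uniq tU uU andbT /=.
  have [/hasP[x /mapP[b bu ->] /mapP[a at_ ba]]|] := boolP (has _ _); last by rewrite
    leq_addr.
  rewrite /= add0n /near.
  have it : (index a t < k)%N by rewrite -[X in (_ < X)%N](size_tuple t) index_mem.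
  have ju : (index b u < k)%N by rewrite -[X in (_ < X)%N](size_tuple u) index_mem.
  rewrite (bigD1 (Ordinal it)) //= (bigD1 (Ordinal ju)) //= tS mul1n -!addnA.
  have [||||cyc det] := merged_closed_walks (x := a) (y := b) (i := index a t) (j :=
    index b u) ct cu.
  - by rewrite size_tuple.
  - by rewrite size_tuple.
  - by rewrite !size_tuple.
  - by rewrite !nth_index.
  rewrite /tangled_walk /closed_walk cyc /=.
  have [/det ->|_] := boolP (consistent _ _); first by rewrite eqxx.
  by rewrite add0n addnCA.
rewrite leq_add2l /near.
under eq_bigr do rewrite exchange_big /=.
rewrite exchange_big /=.
under eq_bigr do under eq_bigr do rewrite exchange_big /=.
under eq_bigr do rewrite exchange_big /=.
have -> : (k ^ 2 * (nb_simple sigma k + nb_tangled sigma (k + k)) =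
   \sum_(i < k) \sum_(j < k) (nb_simple sigma k + nb_tangled sigma (k + k)))%N.
  by rewrite !sum_nat_const card_ord mulnA.
apply: leq_sum => i _; apply: leq_sum => j _.
under eq_bigr do rewrite big_split /=.
rewrite big_split /= leq_add //.
  apply: leq_sum => t _; rewrite -big_distrr /= -[leqRHS]muln1 leq_mul2l; apply/orP;
    right.
  apply: sum_bool_le1 => u u' /eqP tu /eqP tu'.
  by apply/val_inj/(@rot_inj j); rewrite /= -tu -tu'.
rewrite /nb_tangled (sum_tuple_cat k k (fun s => (tangled_walk sigma s : nat))).
rewrite (sum_tuple_rot _ i (fun s => \sum_(u : k.-tuple E) (tangled_walk sigma (s ++
  rot j u) : nat))%N).
by apply: leq_sum => t _; rewrite (sum_tuple_rot _ j (fun s => (tangled_walk sigma (t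
  ++ s) : nat))).
Qed.

Lemma closed_walkE sigma s :
  closed_walk sigma s = (map (fun e => (sigma e).1) s == map fst (rot 1 s)).
Proof. exact: cycle_walk_step. Qed.

Lemma sum_uniq_tuple k : (\sum_(u : k.-tuple 'I_n) uniq u = n ^_ k)%N.
Proof.
rewrite -[n in RHS]card_ord -(card_uniq_tuples k predT) -sum1_card [RHS]big_mkcond /=.
by apply: eq_bigr => u _; rewrite inE all_predT; case: uniq.
Qed.

Lemma sum_nb_simple k :
  (\sum_(sigma : matching n d) nb_simple sigma k =
   n ^_ k * d ^ k * (d ^ k * (n * d - k)`!))%N.
Proof.
rewrite exchange_big /= -sum_uniq_tuple.
rewrite [X in _ = (X * _)%N]mulnC -(sum_tuple_half_edge d _ (fun w : seq 'I_n => uniq w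
  : nat)) big_distrl /=.
apply: eq_bigr => t _; rewrite /simple_walk.
have [tU|] := boolP (uniq (map fst t)); last first.
  by rewrite mul0n big1 // => sigma _; rewrite andbF.
rewrite mul1n -[in RHS](size_tuple t).
rewrite -(@count_matching_uniq n d t (map fst (rot 1 t))).
- by apply: eq_bigr => sigma _; rewrite andbT closed_walkE.
- exact: map_uniq tU.
- by rewrite map_rot rot_uniq.
- by rewrite size_map size_rot.
Qed.

Lemma sum_nb_disjoint_ffact k :
  (\sum_(sigma : matching n d) nb_disjoint sigma k <=
   n ^_ (k + k) * d ^ (k + k) * (d ^ (k + k) * (n * d - (k + k))`!))%N.
Proof.
rewrite exchange_big /= -sum_uniq_tuple.
rewrite [X in (_ <= X * _)%N]mulnC -(sum_tuple_half_edge d _ (fun w : seq 'I_n => uniq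
  w : nat)) big_distrl /=.
rewrite (sum_tuple_cat k k (fun s => uniq (map fst s) * (d ^ (k + k) * (n * d - (k +
  k))`!))%N).
apply: leq_sum => t _; rewrite exchange_big; apply: leq_sum => u _ /=.
have [tuU|] := boolP (uniq (map fst (t ++ u))); last first.
  by rewrite mul0n big1 // => sigma _; rewrite !andbF.
rewrite mul1n; have sz : size (t ++ u) = (k + k)%N by rewrite size_cat !size_tuple.
rewrite -sz; apply: leq_trans (@count_matching_le n d (t ++ u) (map fst (rot 1 t ++ rot
  1 u)) _).
  apply: leq_sum => sigma _; rewrite andbT !closed_walkE !map_cat.
  rewrite eqseq_cat; last by rewrite -map_cat -/(rot 1 t) !size_map size_rot.
  exact: leqnn.
exact: map_uniq tuU.
Qed.

(** A closed walk prescribes the landing vertex of each distinct head; for a repeated head [next]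
    reads the successor of its first occurrence, which is as binding as the others. *)
Lemma sum_tangled_le t :
  (\sum_(sigma : matching n d) tangled_walk sigma t <=
   ~~ consistent fst t * (d ^ size (undup t) * (n * d - size (undup t))`!))%N.
Proof.
rewrite /tangled_walk; case: consistent => /=.
  by rewrite mul0n big1 // => sigma _; rewrite andbF.
rewrite mul1n.
apply: leq_trans (@count_matching_le n d (undup t) (map (fst \o next t) (undup t))
  (undup_uniq _)).
apply: leq_sum => sigma _; rewrite andbT; case: (boolP (closed_walk sigma t)) => // ct.
suff -> : map (fun e => (sigma e).1) (undup t) = map (fst \o next t) (undup t) by
  rewrite eqxx.
apply/eq_in_map => e; rewrite mem_undup => et /=; apply/eqP.
exact: (next_cycle ct et).
Qed.

Lemma size_undup_inconsistent t : ~~ consistent fst t ->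
  (size (undup (map fst t)) < size (undup t))%N.
Proof.
move=> Nc; rewrite ltnNge; apply: contra Nc => le; apply/consistentP.
have uU : uniq (map fst (undup t)).
  apply: (leq_size_uniq (undup_uniq (map fst t))); last by rewrite size_map.
  by move=> x; rewrite mem_undup => /mapP[y yt ->]; rewrite map_f // mem_undup.
move=> x y xt yt xy; apply/eqP/negPn/negP => nxy.
have xu : x \in undup t by rewrite mem_undup.
move: uU; rewrite (perm_uniq (perm_map fst (perm_to_rem xu))) /= => /andP[/negP[]].
apply/mapP; exists y => //; move: yt; rewrite -mem_undup (perm_mem (perm_to_rem xu)) inE.
by rewrite eq_sym (negbTE nxy).
Qed.

End WalkCounts.

(** * Expected numbers of closed walks *)

Lemma ffact_scale_le (n d k : nat) : (0 < d)%N -> (n ^_ k * d ^ k <= (n * d) ^_ k)%N.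
Proof.
move=> d0; elim: k => [|k IHk]; first by rewrite !ffactn0 expn0.
rewrite !ffactnSr expnSr mulnACA leq_mul // mulnBl.
by rewrite leq_sub2l // leq_pmulr.
Qed.

Lemma sum_nb_simple_le (n d k : nat) : (0 < d)%N ->
  (\sum_(sigma : matching n d) nb_simple sigma k <= d ^ k * (n * d)`!)%N.
Proof.
move=> d0; rewrite sum_nb_simple mulnCA leq_mul2l; apply/orP; right.
have [knd|knd] := leqP k (n * d).
  by rewrite -(ffact_fact knd) leq_mul2r ffact_scale_le ?orbT.
by rewrite ffact_small //; nia.
Qed.

Lemma sum_nb_disjoint_le (n d k : nat) : (0 < d)%N ->
  (\sum_(sigma : matching n d) nb_disjoint sigma k <= d ^ (k + k) * (n * d)`!)%N.
Proof.
move=> d0; apply: leq_trans (sum_nb_disjoint_ffact _ _ _) _.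
(* The bound for disjoint pairs is the exact total for simple walks of length k + k. *)
by rewrite -sum_nb_simple sum_nb_simple_le.
Qed.

(** The estimate 1 - k^2/n for the ratio of falling to ordinary power, with truncated
    subtraction. *)
Lemma ffact_ge (n k : nat) : (n ^ k * (n - k ^ 2) <= n * n ^_ k)%N.
Proof.
elim: k => [|k IHk]; first by rewrite expn0 mul1n ffactn0 muln1 leq_subr.
have [nk|kn] := leqP n (k.+1 ^ 2); first by rewrite (eqP (_ : n - k.+1 ^ 2 == 0)%N)
  ?muln0 // subn_eq0.
rewrite ffactnSr mulnA; apply: leq_trans (leq_mul IHk (leqnn _)).
rewrite expnSr -!mulnA leq_mul2l; apply/orP; right.
have kn' : (k * k + 2 * k + 1 < n)%N by move: kn; rewrite expnS expn1; nia.
rewrite !expnS !expn0 !muln1.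
have [m ->] : exists m, n = (k * k + 2 * k + 1 + m)%N by exists (n - (k * k + 2 * k +
  1))%N; lia.
have -> : (k * k + 2 * k + 1 + m - k.+1 * k.+1 = m)%N by lia.
have -> : (k * k + 2 * k + 1 + m - k * k = 2 * k + 1 + m)%N by lia.
have -> : (k * k + 2 * k + 1 + m - k = k * k + k + 1 + m)%N by lia.
nia.
Qed.

Lemma sum_nb_simple_ge (n d k : nat) : (0 < n)%N -> (0 < d)%N -> 
  (d ^ k * (n * d)`! * (n - k ^ 2) <= n * \sum_(sigma : matching n d) nb_simple sigma
    k)%N.
Proof.
move=> n0 d0; rewrite sum_nb_simple.
have [knd|knd] := leqP k (n * d); last first.
  rewrite (eqP (_ : n - k ^ 2 == 0)%N) ?muln0 // subn_eq0.
  apply: leq_trans (_ : n * d <= _)%N; first by rewrite leq_pmulr.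
  by rewrite (leq_trans (ltnW knd)) // expnS expn1 leq_pmulr // (leq_ltn_trans _ knd).
rewrite -(ffact_fact knd).
have h1 : ((n * d) ^_ k <= n ^ k * d ^ k)%N.
  rewrite -expnMn; elim: (k) => [|j IHj]; first by rewrite ffactn0 expn0.
  by rewrite ffactnSr expnSr leq_mul // leq_subr.
have h2 := ffact_ge n k.
set F := ((n * d - k)`!)%N.
have -> : (n * (n ^_ k * d ^ k * (d ^ k * F)) = (n * n ^_ k) * (d ^ k * d ^ k * F))%N
  by lia.
apply: leq_trans (leq_mul h2 (leqnn _)).
have -> : (d ^ k * ((n * d) ^_ k * F) * (n - k ^ 2) = (n * d) ^_ k * (d ^ k * F * (n -
  k ^ 2)))%N by lia.
apply: leq_trans (leq_mul h1 (leqnn _)) _.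
lia.
Qed.

(** A new entry is either fresh, with at most n choices, or one of at most k old ones, each paying a
    factor n: together at most (k + 1) n. *)
Lemma sum_undup_tuple_le (n k : nat) :
  (\sum_(u : k.-tuple 'I_n) n ^ (k - size (undup u)) <= k`! * n ^ k)%N.
Proof.
elim: k => [|k IHk].
  by rewrite (sum_tuple0 (fun s : seq 'I_n => n ^ (0 - size (undup s)))%N) sub0n fact0.
rewrite (sum_tuple_cons _ (fun s : seq 'I_n => n ^ (k.+1 - size (undup s)))%N)
  exchange_big /=.
have step (u : k.-tuple 'I_n) :
    (\sum_x n ^ (k.+1 - size (if x \in val u then undup u else x :: undup u)) <=
     k.+1 * n * n ^ (k - size (undup u)))%N.
  have su : (size (undup u) <= k)%N by rewrite -[leqRHS](size_tuple u) size_undup.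
  rewrite (bigID (mem (val u))) /= mulSn mulnDl addnC leq_add //.
    rewrite (eq_bigr (fun=> n ^ (k - size (undup u)))%N) => [|x /negbTE -> //].
    by rewrite sum_nat_const leq_mul // -[leqRHS]card_ord max_card.
  rewrite (eq_bigr (fun=> n ^ (k.+1 - size (undup u)))%N) => [|x -> //].
  rewrite sum_nat_const subSn // expnS mulnA leq_mul // leq_mul //.
  by rewrite (leq_trans (card_size _)) // size_tuple.
apply: (@leq_trans (\sum_(u : k.-tuple 'I_n) k.+1 * n * n ^ (k - size (undup u)))%N).
  by apply: leq_sum => u _; exact: step.
rewrite -big_distrr /= factS expnS.
apply: leq_trans (leq_mul (leqnn _) IHk) _.
lia.
Qed.

Lemma exp_le_ffact (N m : nat) : (2 * m <= N)%N -> (N ^ m <= 2 ^ m * N ^_ m)%N.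
Proof.
elim: m => [|m IHm] mN; first by rewrite !expn0 ffactn0.
rewrite !expnSr ffactnSr mulnACA leq_mul ?IHm; lia.
Qed.

(** With m distinct heads the constraint has probability at most 2^m n^(-m), the power of 2 paying
    for (nd)^m against the falling factorial. A tangled walk has v < m vertices, which leaves a
    spare factor 1/n. Multiplying by n^k keeps the computation in the naturals. *)
Lemma sum_nb_tangled_le (n d k : nat) : (0 < n)%N -> (0 < d)%N -> (2 * k <= n * d)%N ->
  (n * \sum_(sigma : matching n d) nb_tangled sigma k <= 2 ^ k * d ^ k * k`! * (n *
    d)`!)%N.
Proof.
move=> n0 d0 knd; rewrite exchange_big /=.
rewrite -(leq_pmul2l (m := n ^ k)) ?expn_gt0 ?n0 //.
have step (t : k.-tuple (half_edge n d)) :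
    (n ^ k * n * \sum_(sigma : matching n d) tangled_walk sigma t <=
     2 ^ k * (n * d)`! * n ^ (k - size (undup (map fst t))))%N.
  apply: leq_trans (leq_mul (leqnn _) (sum_tangled_le t)) _.
  have [_|/size_undup_inconsistent sv] := boolP (consistent _ _); first by rewrite
    mul0n muln0.
  rewrite mul1n.
  have sm : (size (undup t) <= k)%N by rewrite -[leqRHS](size_tuple t) size_undup.
  set m := size (undup t) in sv sm *; set v := size _ in sv *.
  have mnd : (m <= n * d)%N by lia.
  have -> : (n ^ k * n = n ^ m * n ^ (k - m + 1))%N by rewrite -expnD addnA subnKC //
    -expnSr addn1.
  have -> : (n ^ m * n ^ (k - m + 1) * (d ^ m * (n * d - m)`!) =
    (n * d) ^ m * (n * d - m)`! * n ^ (k - m + 1))%N by rewrite expnMn; lia.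
  apply: leq_mul; last by rewrite leq_pexp2l //; lia.
  rewrite -(ffact_fact mnd) mulnA leq_mul2r; apply/orP; right.
  apply: leq_trans (exp_le_ffact _) _; first lia.
  by rewrite leq_mul2r leq_exp2l // sm orbT.
rewrite mulnA big_distrr /=.
apply: (@leq_trans (\sum_(t : k.-tuple (half_edge n d))
    2 ^ k * (n * d)`! * n ^ (k - size (undup (map fst t))))%N).
  by apply: leq_sum => t _; exact: step.
rewrite -big_distrr /= (sum_tuple_half_edge d _ (fun w : seq 'I_n => n ^ (k - size
  (undup w)))%N).
apply: leq_trans (leq_mul (leqnn _) (leq_mul (leqnn _) (sum_undup_tuple_le n k))) _.
lia.
Qed.

(** The O(1/n) part of the variance bound: tangled walks of length 2k, then the relative loss k^2/n
    in the mean, which enters through the cross term. *)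
Definition variance_error (d k : nat) : nat :=
  (k ^ 2 * (2 ^ (k + k) * d ^ (k + k) * (k + k)`!) + 2 * k ^ 2 * d ^ (k + k))%N.

Lemma variance_nb_simple (R : realFieldType) (n d k : nat) :
  (0 < n)%N -> (0 < d)%N -> (2 * (k + k) <= n * d)%N ->
  \sum_(sigma : matching n d) ((nb_simple sigma k)%:R - d%:R ^+ k) ^+ 2 <=
  (n * d)`!%:R * (k%:R ^+ 2 * d%:R ^+ k + (variance_error d k)%:R / n%:R) :> R.
Proof.
move=> n0 d0 knd.
have n0R : 0 < n%:R :> R by rewrite ltr0n.
pose SX : R := (\sum_(sigma : matching n d) nb_simple sigma k)%:R.
pose SD : R := (\sum_(sigma : matching n d) nb_disjoint sigma k)%:R.
pose SB : R := (\sum_(sigma : matching n d) nb_tangled sigma (k + k))%:R.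
pose M : R := (n * d)`!%:R.
pose D : R := d%:R ^+ k.
have M0 : 0 <= M by rewrite ler0n.
have D0 : 0 <= D by rewrite exprn_ge0.
have hX : SX <= D * M by rewrite /SX /D /M -natrX -natrM ler_nat sum_nb_simple_le.
have hXl : D * M * (n%:R - k%:R ^+ 2) <= n%:R * SX.
  have [nk|kn] := leqP n (k ^ 2).
    apply: (@le_trans _ _ 0); last by rewrite mulr_ge0 ?ler0n.
    by rewrite mulr_ge0_le0 ?mulr_ge0 // subr_le0 -natrX ler_nat.
  rewrite /SX /D /M -!natrX -natrB ?(ltnW kn) // -!natrM ler_nat.
  exact: sum_nb_simple_ge.
have hD : SD <= D * D * M.
  by rewrite /SD /D /M -!natrX -!natrM ler_nat -expnD sum_nb_disjoint_le.
have hB : n%:R * SB <= (2 ^ (k + k) * d ^ (k + k) * (k + k)`!)%N%:R * M.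
  by rewrite /SB /M -!natrM ler_nat sum_nb_tangled_le.
have hsum : \sum_(sigma : matching n d) ((nb_simple sigma k)%:R - d%:R ^+ k) ^+ 2 <=
    SD + k%:R ^+ 2 * (SX + SB) - 2 * D * SX + D * D * M.
  have -> : SD + k%:R ^+ 2 * (SX + SB) - 2 * D * SX + D * D * M =
     \sum_(sigma : matching n d) ((nb_disjoint sigma k)%:R +
       k%:R ^+ 2 * ((nb_simple sigma k)%:R + (nb_tangled sigma (k + k))%:R)
       - 2 * D * (nb_simple sigma k)%:R + D * D).
    rewrite !big_split /= sumrN -!mulr_sumr big_split /= -!natr_sum sumr_const.
    by rewrite card_permT card_half_edge -[_ *+ (n * d)`!]mulr_natr -[D * D * M]mulrA.
  apply: ler_sum => sigma _.
  have := nb_simple_sqr sigma k; rewrite -(ler_nat R) natrX natrD natrM natrD natrX -/D.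
  set x := (nb_simple sigma k)%:R; set y := (nb_disjoint _ _)%:R; set z := (nb_tangled
    _ _)%:R.
  move=> h; nra.
apply: (le_trans hsum); rewrite -/M -/D.
rewrite -(ler_pM2l n0R).
have -> : n%:R * (M * (k%:R ^+ 2 * D + (variance_error d k)%:R / n%:R)) =
  M * (n%:R * k%:R ^+ 2 * D + (variance_error d k)%:R) by field; rewrite gt_eqF.
have k0 : 0 <= k%:R ^+ 2 :> R by rewrite exprn_ge0.
pose C : R := (2 ^ (k + k) * d ^ (k + k) * (k + k)`!)%N%:R.
have -> : (variance_error d k)%:R = k%:R ^+ 2 * C + 2 * k%:R ^+ 2 * (D * D).
  by rewrite /variance_error natrD natrM natrX [(2 * _ * _)%N%:R]natrM [(2 *
    _)%N%:R]natrM !natrX exprD.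
rewrite -/C in hB.
move: (n%:R : R) (k%:R ^+ 2 : R) n0R k0 hX hXl hD hB => nn kk n0R k0 hX hXl hD hB.
have h1 : nn * SD <= nn * (D * D * M) by rewrite ler_pM2l.
have h2 : nn * kk * SX <= nn * kk * (D * M) by rewrite ler_wpM2l // mulr_ge0 // ltW.
have h3 : kk * (nn * SB) <= kk * (C * M) by rewrite ler_wpM2l.
have h4 : 2 * D * (D * M * (nn - kk)) <= 2 * D * (nn * SX) by rewrite ler_wpM2l //
  mulr_ge0.
lra.
Qed.

(** * Spectrum of the transition matrix *)

Section Spectrum.
Variables (R : realType) (n d : nat) (sigma : matching n d).
Hypotheses (n_gt0 : (0 < n)%N) (d_gt0 : (0 < d)%N).
Local Notation E := (half_edge n d).
Local Notation C := R[i].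
Let P : 'M[C]_n := transition_matrix R sigma.
Let B : 'M[C]_n := map_mx (real_complex R) (centered_transition R sigma).

Lemma transition_matrixE u v :
  P u v = (\sum_(e : E) (e.1 == u) * ((sigma e).1 == v))%N%:R / d%:R.
Proof.
rewrite mxE -sum1_card big_mkcond /=; congr (_%:R / _); apply: eq_bigr => e _.
by rewrite !inE; case: eqP => _; case: eqP.
Qed.

Lemma centered_transitionE : B = P - const_mx n%:R^-1.
Proof.
apply/matrixP => u v; rewrite 2!mxE [RHS]mxE [X in _ = _ + X]mxE [X in _ = _ - X]mxE
  transition_matrixE.
have dN0 : d%:R != 0 :> C by rewrite pnatr_eq0 -lt0n.
rewrite rmorph_sum /=.
rewrite (eq_bigr (fun e : E => ((e.1 == u)%:R / d%:R) * ((sigma e).1 == v)%:R -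
    ((e.1 == u)%:R / d%:R) * n%:R^-1 : C)); last first.
  move=> e _; rewrite -mulrBr /proj1C card_ord !(rmorphM, rmorphB) /=.
  by rewrite !fmorphV !rmorph_nat.
rewrite sumrB -mulr_suml; congr (_ - _).
  rewrite natr_sum mulr_suml; apply: eq_bigr => e _.
  by rewrite natrM mulrAC.
rewrite (sum_half_edge d (fun w => (w == u)%:R / d%:R : C)).
rewrite (bigD1 u) //= eqxx big1 ?addr0 => [|w /negbTE->]; last by rewrite mul0r.
by rewrite mul1r divff // mul1r.
Qed.

(** Rows of P sum to 1, so (X - P) J = (X - 1) J and (X - P)((X - 1) + J) = (X - 1)(X - P + J),
    where J has all entries 1/n. Determinants show that centering only replaces the eigenvalue 1 by
    0. *)
Lemma char_poly_centered (l : seq C) :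
  char_poly P = ('X - 1) * \prod_(z <- l) ('X - z%:P) ->
  char_poly B = 'X * \prod_(z <- l) ('X - z%:P).
Proof.
move=> Pl.
have nN0 : n%:R != 0 :> C by rewrite pnatr_eq0 -lt0n.
pose J : 'M[{poly C}]_n := const_mx (n%:R^-1)%:P.
have X1 : 'X - 1 != 0 :> {poly C} by rewrite -polyC1 polyXsubC_eq0.
have BJ : char_poly_mx B = char_poly_mx P + J.
  rewrite centered_transitionE /char_poly_mx map_mxB -addrA opprB [- _ + _]addrC.
  congr (_ + _); congr (_ - _).
  by apply/matrixP => i j; rewrite !mxE.
have PJ : char_poly_mx P *m J = ('X - 1) *: J.
  have ent i k : char_poly_mx P i k = 'X *+ (i == k) - (P i k)%:P.
    by rewrite [LHS]mxE [X in X + _]mxE [X in _ + X]mxE [X in - X]mxE.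
  apply/matrixP => i j; rewrite [LHS]mxE [RHS]mxE.
  under eq_bigr do rewrite ent [J _ _]mxE.
  rewrite [J i j]mxE -mulr_suml sumrB -(rmorph_sum (@polyC C))
    transition_matrix_row_sum //.
  congr ((_ - _) * _).
  by rewrite (bigD1 i) //= eqxx big1 ?addr0 // => k; rewrite eq_sym => /negbTE->.
have key : char_poly_mx P *m (('X - 1)%:M + J) = ('X - 1) *: char_poly_mx B.
  by rewrite mulmxDr mul_mx_scalar PJ BJ [RHS]scalerDr.
have := congr1 determinant key; rewrite det_mulmx detZ => e.
have := det_scalar_const n (n%:R^-1)%:P X1.
rewrite -polyCMn -[n%:R^-1 *+ n]mulr_natr mulVf // polyC1 subrK => dJ.
have : 'X * char_poly P = ('X - 1) * char_poly B.
  apply: (mulfI (expf_neq0 n X1)).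
  rewrite [LHS]mulrA -dJ [RHS]mulrCA -[X in _ = _ * X]e.
  by rewrite -[LHS]mulrA [LHS]mulrC -[LHS]mulrA.
rewrite Pl mulrCA => /(mulfI X1) <-.
by [].
Qed.

Fixpoint walk_from (u : 'I_n) (s : seq E) (v : 'I_n) : bool :=
  if s is e :: s' then (e.1 == u) && walk_from (sigma e).1 s' v else u == v.

Lemma transition_matrixX k u v :
  (P ^+ k) u v = (\sum_(t : k.-tuple E) walk_from u t v)%N%:R / d%:R ^+ k.
Proof.
elim: k u v => [|k IHk] u v.
  rewrite (sum_tuple0 (fun s => walk_from u s v : nat)) /= !expr0 mxE.
  by rewrite divr1.
rewrite (sum_tuple_cons _ (fun s => walk_from u s v : nat)) /= exprS mxE.
transitivity ((\sum_w (\sum_(e : E) (e.1 == u) * ((sigma e).1 == w))%N%:R *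
    (\sum_(t : k.-tuple E) walk_from w t v)%N%:R) * (d%:R^-1 * d%:R ^- k) : C).
  rewrite mulr_suml; apply: eq_bigr => w _.
  by rewrite (IHk w v) [P u w]transition_matrixE mulrACA.
rewrite exprS invfM.
congr (_ * _).
rewrite [RHS]natr_sum.
transitivity (\sum_w \sum_(e : E) (((e.1 == u) * ((sigma e).1 == w))%N%:R *
    (\sum_(t : k.-tuple E) walk_from w t v)%N%:R) : C).
  by apply: eq_bigr => w _; rewrite natr_sum mulr_suml.
rewrite exchange_big /=; apply: eq_bigr => e _.
rewrite (bigD1 (sigma e).1) //= eqxx muln1 [X in _ + X]big1 ?addr0 => [|w]; last first.
  by rewrite eq_sym => /negbTE ->; rewrite muln0 mul0r.
rewrite -natrM big_distrr /=; congr (_%:R).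
by case: eqP => _ /=; [under eq_bigr do rewrite mul1n | rewrite !big1].
Qed.

Lemma walk_from_path a s v :
  walk_from (sigma a).1 (s : seq E) v =
  path (walk_step fst (fun e => (sigma e).1)) a s && ((sigma (last a s)).1 == v).
Proof. by elim: s a => [|b s IHs] a //=; rewrite IHs eq_sym andbA. Qed.

Lemma mxtrace_transition_matrixX k : (0 < k)%N ->
  \tr (P ^+ k) = (nb_walks sigma k)%:R / d%:R ^+ k.
Proof.
move=> k0; rewrite /mxtrace; under eq_bigr do rewrite transition_matrixX.
rewrite -mulr_suml -natr_sum; congr (_%:R / _).
rewrite exchange_big /=; apply: eq_bigr => t _.
rewrite /closed_walk; case: (val t) (size_tuple t) => [|e s] /=.
  by move=> k1; rewrite -k1 in k0.
move=> _; rewrite (bigD1 e.1) //= eqxx [X in (_ + X)%N]big1 ?addn0 => [|u]; last first.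
  by rewrite eq_sym => /negbTE ->.
by rewrite walk_from_path rcons_path.
Qed.

End Spectrum.

(** * Newton identities and zero-free disks *)

Section ZeroFree.
Variable F : numFieldType.
Implicit Types (s : seq F) (f g h : {poly F}).

(* Reversed characteristic polynomial of a matrix with eigenvalues [s]. *)
Definition rev_char s : {poly F} := \prod_(z <- s) (1 - z *: 'X).

Definition geom_poly (K : nat) (z : F) : {poly F} := \sum_(i < K.+1) (z *: 'X) ^+ i.

(** Up to degree [K] the coefficients are the complete homogeneous symmetric functions of [s];
    beyond it they are artefacts of truncation. *)
Definition complete_poly (K : nat) s : {poly F} := \prod_(z <- s) geom_poly K z.

Definition power_sum_poly (K : nat) s : {poly F} := \sum_(z <- s) (geom_poly K z - 1).

(** Truncated power series identities are stated as polynomial identities with an explicit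
    remainder. *)
Definition eq_modX (m : nat) f g := exists r, f = g + r * 'X^m.

Lemma geom_polyP K z : (1 - z *: 'X) * geom_poly K z = 1 - (z ^+ K.+1)%:P * 'X^(K.+1).
Proof.
have := subrX1 (z *: 'X : {poly F}) K.+1; rewrite -/(geom_poly K z) exprZn => e.
by rewrite mul_polyC -[RHS]opprB e -mulNr opprB.
Qed.

Lemma coef_geom_poly K z i : (geom_poly K z)`_i = if (i <= K)%N then z ^+ i else 0.
Proof.
rewrite /geom_poly; under eq_bigr do rewrite exprZn.
have -> : \sum_(j < K.+1) z ^+ j *: 'X^j = \poly_(j < K.+1) z ^+ j :> {poly F}.
  by rewrite poly_def.
by rewrite coef_poly ltnS.
Qed.

Lemma rev_char_complete K s :
  eq_modX K.+1 (rev_char s * complete_poly K s) 1.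
Proof.
elim: s => [|z s [r IHs]].
  by exists 0; rewrite /rev_char /complete_poly !big_nil mul0r addr0 mul1r.
exists (r - (z ^+ K.+1)%:P - (z ^+ K.+1)%:P * r * 'X^(K.+1)).
rewrite /rev_char /complete_poly !big_cons mulrACA geom_polyP.
rewrite -/(rev_char s) -/(complete_poly K s) IHs; ring.
Qed.

Lemma newton_rev_char K s :
  eq_modX K.+1 ('X * (rev_char s)^`() + rev_char s * power_sum_poly K s) 0.
Proof.
elim: s => [|z s [r IHs]].
  exists 0; rewrite /rev_char /power_sum_poly !big_nil derivC; ring.
exists ((1 - z *: 'X) * r - (z ^+ K.+1)%:P * rev_char s).
rewrite /rev_char /power_sum_poly !big_cons -/(rev_char s) -/(power_sum_poly K s).
have -> : ((1 - z *: 'X) * rev_char s)^`() =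
    - (z%:P * rev_char s) + (1 - z *: 'X) * (rev_char s)^`().
  by rewrite derivM derivB derivC derivZ derivX sub0r mulNr alg_polyC.
rewrite add0r in IHs.
transitivity ((1 - z *: 'X) * ('X * (rev_char s)^`() + rev_char s * power_sum_poly K s)
   + rev_char s * ((1 - z *: 'X) * geom_poly K z - 1)).
  rewrite -mul_polyC; ring.
rewrite IHs geom_polyP; ring.
Qed.

(** Differentiate q h = 1 modulo X^(K+1), insert Newton's identity for q, and cancel q by
    multiplying with h. *)
Lemma newton_complete K s :
  eq_modX K.+1 ('X * (complete_poly K s)^`()) (power_sum_poly K s * complete_poly K s).
Proof.
have [r1 e1] := rev_char_complete K s; have [r2] := newton_rev_char K s.
set q := rev_char s in e1 *; set h := complete_poly K s in e1 *.
set p := power_sum_poly K s; rewrite add0r => e2.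
(* The factor X restores the degree that differentiation takes from the remainder. *)
have e3 : 'X * (q^`() * h + q * h^`()) = (K.+1%:R * r1 + 'X * r1^`()) * 'X^(K.+1).
  rewrite -derivM e1 derivD derivC derivM derivXn /= -mulr_natl exprS; ring.
exists ((K.+1%:R * r1 + 'X * r1^`() - r2 * h) * h - r1 * ('X * h^`() - p * h)).
have e4 : 'X * h^`() * (q * h) =
   (K.+1%:R * r1 + 'X * r1^`()) * 'X^(K.+1) * h - (r2 * 'X^(K.+1) - q * p) * h * h.
  rewrite -e3 -e2; ring.
have e5 : 'X * h^`() - p * h =
  ('X * h^`() - p * h) * (q * h) - ('X * h^`() - p * h) * (r1 * 'X^(K.+1)).
  rewrite e1; ring.
apply/eqP; rewrite -subr_eq0 opprD addrA {1}e5 mulrBl e4; apply/eqP; ring.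
Qed.

Lemma coef_eq_modX m f g i : eq_modX m f g -> (i < m)%N -> f`_i = g`_i.
Proof. by move=> [r ->] im; rewrite coefD coefMXn im addr0. Qed.

Lemma complete_poly0 K s : (complete_poly K s)`_0 = 1.
Proof.
rewrite -horner_coef0 /complete_poly horner_prod big1 // => z _.
by rewrite horner_coef0 coef_geom_poly expr0.
Qed.

Lemma coef_power_sum K s i :
  (power_sum_poly K s)`_i = if (0 < i <= K)%N then \sum_(z <- s) z ^+ i else 0.
Proof.
rewrite /power_sum_poly coef_sum; case: ifP => [/andP[i0 iK]|].
  apply: eq_bigr => z _; rewrite coefB coef_geom_poly iK coef1.
  by case: (i) i0 => // j _; rewrite subr0.
move=> Ni; apply: big1 => z _; rewrite coefB coef_geom_poly coef1.
by case: i Ni => [_|i /= ->]; rewrite ?expr0 ?subrr.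
Qed.

Lemma sum_bin_diag B j : (\sum_(i < j) 'C(B + i, B) = 'C(B + j, B.+1))%N.
Proof.
elim: j => [|j IHj]; first by rewrite big_ord0 addn0 bin_small.
by rewrite big_ord_recr /= IHj addnS binS addnC.
Qed.

(** Comparison with (1 - a X)^(-(B+1)), whose coefficients are C(B + j, B) a^j: in the recursion for
    j times the j-th coefficient they sum up by the hockey stick identity. *)
Lemma coef_complete_le K B s (a : F) : 0 < a ->
  (forall k, (0 < k <= K)%N -> `|\sum_(z <- s) z ^+ k| <= B%:R * a ^+ k) ->
  forall j, (j <= K)%N -> `|(complete_poly K s)`_j| <= 'C(B + j, B)%:R * a ^+ j.
Proof.
move=> a0 pB; elim/ltn_ind => -[|j] IHj jK.
  by rewrite complete_poly0 normr1 addn0 binn expr0 mulr1.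
have := coef_eq_modX (newton_complete K s) (jK : (j.+1 < K.+1)%N).
rewrite coefXM /= coef_deriv coefM big_ord_recl coef_power_sum mul0r add0r => e.
have j0 : 0 < j.+1%:R :> F by rewrite ltr0n.
rewrite -(ler_pM2l j0) -[j.+1%:R in leLHS]ger0_norm ?ler0n // -normrM [X in
  `|X|]mulr_natl e.
apply: (le_trans (ler_norm_sum _ _ _)).
apply: (@le_trans _ _ (\sum_(i < j.+1) B%:R * a ^+ j.+1 * 'C(B + (j - i), B)%:R)).
  apply: ler_sum => i _; rewrite /= /bump /= add1n normrM coef_power_sum subSS.
  have ij : (i <= j)%N by rewrite -ltnS.
  have iK : (0 < i.+1 <= K)%N by rewrite (leq_trans _ jK).
  rewrite iK; apply: le_trans (ler_pM _ _ (pB _ iK) (IHj (j - i)%N _ _)) _ => //.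
  - by rewrite ltnS leq_subr.
  - by rewrite (leq_trans (leq_subr _ _)) // ltnW.
  - rewrite mulrACA [leRHS]mulrAC -exprD addSn subnKC //.
rewrite -mulr_sumr -natr_sum (reindex_inj rev_ord_inj) /=.
rewrite (eq_bigr (fun i : 'I_j.+1 => 'C(B + i, B))) => [|i _]; last first.
  by rewrite subSS subKn // -ltnS.
rewrite sum_bin_diag mulrAC [leRHS]mulrA ler_wpM2r ?exprn_ge0 ?(ltW a0) //.
rewrite -!natrM ler_nat.
have := mul_bin_left (B + j.+1) B; rewrite addKn => <-.
by rewrite leq_mul2r leqnSn orbT.
Qed.

(** At a zero 1/z of q in the disk, the tail of q H beyond degree K would have to equal -1, while it
    is at most a geometric series with ratio a / rho. The smallness hypothesis says exactly that
    this series is below 1. *)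
Lemma zero_free K B s (a rho c : F) : 0 < a -> a < rho ->
  (forall i, `|(rev_char s)`_i| <= c * a ^+ i) ->
  (forall k, (0 < k <= K)%N -> `|\sum_(z <- s) z ^+ k| <= B%:R * a ^+ k) ->
  c * 'C(B + K.+1, B.+1)%:R * (a / rho) ^+ K.+1 < 1 - a / rho ->
  forall z, z \in s -> `|z| < rho.
Proof.
move=> a0 ar qc pB small z zs.
have rho0 : 0 < rho by exact: lt_trans ar.
have c0 : 0 <= c by have := qc 0%N; rewrite expr0 mulr1; apply: le_trans.
rewrite real_ltNge ?normr_real ?gtr0_real //; apply/negP => rz.
have z0 : z != 0 by rewrite -normr_gt0 (lt_le_trans rho0).
(* The power sums control [complete_poly] only up to degree [K], hence the cut. *)
pose H := take_poly K.+1 (complete_poly K s).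
pose S := rev_char s * H.
have qz : S.[z^-1] = 0.
  rewrite hornerM [X in X * _](_ : _ = 0) ?mul0r //.
  rewrite /rev_char horner_prod; apply/eqP; rewrite prodf_seq_eq0; apply/hasP; exists z
    => //=.
  by rewrite !hornerE mulfV ?subrr.
have S1 i : (i <= K)%N -> S`_i = (i == 0)%:R.
  move=> iK; rewrite -coef1 -(coef_eq_modX (rev_char_complete K s)) ?ltnS //.
  rewrite !coefM; apply: eq_bigr => j _; congr (_ * _).
  by rewrite coef_take_poly ltnS (leq_trans (leq_subr _ _)).
have Sbound m : `|S`_m| <= c * 'C(B + K.+1, B.+1)%:R * a ^+ m.
  rewrite coefMr; apply: (le_trans (ler_norm_sum _ _ _)).
  apply: (@le_trans _ _ (\sum_(j < m.+1 | (j < K.+1)%N) c * a ^+ m * 'C(B + j, B)%:R)).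
    rewrite [leRHS]big_mkcond; apply: ler_sum => j _ /=.
    rewrite normrM coef_take_poly; case: ifP => jK; last by rewrite normr0 mulr0.
    apply: le_trans (ler_pM _ _ (qc _) (coef_complete_le a0 pB _)) _ => //.
    by rewrite mulrACA [leRHS]mulrAC -exprD subnK // -ltnS.
  rewrite -mulr_sumr -natr_sum mulrAC ler_wpM2r ?exprn_ge0 ?(ltW a0) // ler_wpM2l //
    ler_nat.
  rewrite -sum_bin_diag (big_ord_widen_cond (maxn m.+1 K.+1) (fun j => (j < K.+1)%N)
    (fun j => 'C(B + j, B))) ?leq_maxl //.
  rewrite [leqRHS](big_ord_widen (maxn m.+1 K.+1) (fun j => 'C(B + j, B))) ?leq_maxr //.
  rewrite big_mkcond [leqRHS]big_mkcond /=; apply: leq_sum => j _.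
  by case: (j < K.+1)%N; rewrite ?andbF //=; case: ifP.
pose th := a / rho.
have th0 : 0 < th by rewrite divr_gt0.
have th1 : 0 < 1 - th by rewrite subr_gt0 ltr_pdivrMr // mul1r.
have cth0 : 0 <= c * 'C(B + K.+1, B.+1)%:R * th ^+ K.+1.
  by rewrite !mulr_ge0 ?exprn_ge0 ?(ltW th0).
have rx : `|z^-1| <= rho^-1 by rewrite normfV lef_pV2 ?posrE ?normr_gt0.
have := horner_coef_wide z^-1 (leq_maxl (size S) K.+1); rewrite qz.
have [M ->] : exists M, maxn (size S) K.+1 = (K.+1 + M)%N.
  by exists (maxn (size S) K.+1 - K.+1)%N; rewrite subnKC // leq_maxr.
rewrite big_split_ord /= big_ord_recl /= S1 // eqxx mulr1n expr0 mulr1 [X in _ + X +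
  _]big1 ?addr0; last first.
  by move=> i _; rewrite S1 ?mul0r // /bump /= add1n ltn_ord.
set T := \sum_(i < M) _ => /esym/eqP; rewrite addr_eq0 => /eqP T1.
have : 1 <= c * 'C(B + K.+1, B.+1)%:R * th ^+ K.+1 * \sum_(i < M) th ^+ i.
  have T_norm : `|T| = 1 by rewrite -normrN -T1 normr1.
  rewrite -[leLHS]T_norm mulr_sumr; apply: (le_trans (ler_norm_sum _ _ _)).
  apply: ler_sum => i _; rewrite normrM normrX -mulrA -exprD [th ^+ _]expr_div_n.
  rewrite mulrA -exprVn; apply: ler_pM => //.
  by rewrite lerXn2r ?nnegrE // invr_ge0 ltW.
apply/negP; rewrite -real_ltNge ?real1 ?ger0_real //; last first.
  by rewrite mulr_ge0 // sumr_ge0 // => i _; rewrite exprn_ge0 // ltW.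
rewrite -(ltr_pM2r th1) mul1r -[X in X < _]mulrA [X in _ * X < _]mulrC.
have -> : (1 - th) * \sum_(i < M) th ^+ i = 1 - th ^+ M.
  by rewrite -[RHS]opprB subrX1 -[RHS]mulNr opprB.
apply: le_lt_trans small; rewrite ler_piMr //.
by rewrite gerBl exprn_ge0 ?ltW.
Qed.

End ZeroFree.

(** * Choice of the constants *)

(** One term of the binomial expansion of (eta + (1 - eta))^(B + K) = 1; it trades polynomial growth
    in K for an exponential arbitrarily close to 1. *)
Lemma bin_exp_le1 (R : realFieldType) (eta : R) (B K : nat) : 0 <= eta <= 1 ->
  'C(B + K, B)%:R * eta ^+ K * (1 - eta) ^+ B <= 1.
Proof.
move=> /andP[e0 e1].
have e : (eta + (1 - eta)) ^+ (B + K) = 1 by rewrite addrC subrK expr1n.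
rewrite -[leRHS]e [leRHS]exprDn; have Bn : (B < (B + K).+1)%N by rewrite ltnS leq_addr.
rewrite (bigD1 (Ordinal Bn)) //= addKn -[X in _ <= X + _]mulr_natl mulrA lerDl sumr_ge0
  // => i _.
by rewrite mulrn_wge0 // mulr_ge0 // exprn_ge0 // subr_ge0.
Qed.

Lemma sum_geom_le (R : realFieldType) (x : R) (m : nat) : 0 <= x < 1 ->
  \sum_(i < m) x ^+ i <= (1 - x)^-1.
Proof.
move=> /andP[x0 x1]; have y0 : 0 < 1 - x by rewrite subr_gt0.
rewrite -(ler_pM2l y0) mulfV ?gt_eqF //.
have -> : (1 - x) * \sum_(i < m) x ^+ i = 1 - x ^+ m.
  by have e := subrX1 x m; rewrite -[RHS]opprB e -[RHS]mulNr opprB.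
by rewrite gerBl exprn_ge0.
Qed.

(** With y halfway between x and 1, i^2 <= 2 C(i + 2, 2) <= 2 (1 - y)^(-2) y^(-i), and a geometric
    series of ratio x / y remains. *)
Lemma sum_sqr_geom_bounded (R : realFieldType) (x : R) : 0 < x < 1 ->
  exists S : R, forall m, \sum_(i < m) i%:R ^+ 2 * x ^+ i <= S.
Proof.
move=> /andP[x0 x1]; pose y := (1 + x) / 2.
have xy : x < y by rewrite /y; lra.
have y1 : y < 1 by rewrite /y; lra.
have y0 : 0 < y by exact: lt_trans xy.
have u0 : 0 < 1 - y by rewrite subr_gt0.
exists (2 * (1 - y) ^- 2 * (1 - x / y)^-1) => m.
apply: (@le_trans _ _ (\sum_(i < m) 2 * (1 - y) ^- 2 * (x / y) ^+ i)); last first.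
  have xy1 : 0 <= x / y < 1 by rewrite divr_ge0 ?(ltW x0) ?(ltW y0) //= ltr_pdivrMr //
    mul1r.
  rewrite -mulr_sumr; apply: ler_wpM2l; last exact: sum_geom_le.
  by rewrite mulr_ge0 // invr_ge0 exprn_ge0 ?(ltW u0).
apply: ler_sum => i _; rewrite expr_div_n.
have h := @bin_exp_le1 R y 2 i; rewrite (ltW y0) (ltW y1) in h.
have {h}h := h isT.
have b : i%:R ^+ 2 <= 2 * 'C(2 + i, 2)%:R :> R.
  by rewrite -natrX -natrM ler_nat mul_bin_left bin1 expnS expn1; nia.
have yi : 0 < y ^+ i by rewrite exprn_gt0.
have u2 : 0 < (1 - y) ^+ 2 by rewrite exprn_gt0.
have -> : 2 * (1 - y) ^- 2 * (x ^+ i / y ^+ i) = (2 / ((1 - y) ^+ 2 * y ^+ i)) * x ^+ i.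
  by field; rewrite ?gt_eqF.
rewrite ler_wpM2r ?exprn_ge0 ?(ltW x0) //.
apply: (le_trans b); rewrite ler_pdivlMr ?mulr_gt0 //.
have -> : 2 * 'C(2 + i, 2)%:R * ((1 - y) ^+ 2 * y ^+ i) =
  2 * ('C(2 + i, 2)%:R * y ^+ i * (1 - y) ^+ 2) by ring.
by rewrite -[leRHS]mulr1 ler_wpM2l.
Qed.

Lemma exists_bin_exp_lt (R : realType) (c x : R) (B : nat) : 0 <= c -> 0 < x < 1 ->
  exists K : nat, c * 'C(B + K.+1, B.+1)%:R * x ^+ K.+1 < 1 - x.
Proof.
move=> c0 /andP[x0 x1]; pose y := (1 + x) / 2.
have xy : x < y by rewrite /y; lra.
have y1 : y < 1 by rewrite /y; lra.
have y0 : 0 < y by exact: lt_trans xy.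
have u0 : 0 < 1 - y by rewrite subr_gt0.
have u1 : 0 < 1 - x by rewrite subr_gt0.
pose M := c * (1 - y) ^- B.+1.
have M0 : 0 <= M by rewrite mulr_ge0 // invr_ge0 exprn_ge0 ?ltW.
have M1 : 0 < M + 1 by rewrite ltr_wpDl.
have t1 : `|x / y| < 1.
  by rewrite ger0_norm ?ltr_pdivrMr ?mul1r // divr_ge0 // ltW.
have /cvgrPdist_lt/(_ ((1 - x) / (M + 1))) := cvg_expr t1.
rewrite divr_gt0 // => /(_ isT)[K _ /(_ K)] /= /(_ (leqnn _)).
have t0 : 0 <= (x / y) ^+ K by rewrite exprn_ge0 // divr_ge0 // ltW.
rewrite sub0r normrN ger0_norm //.
rewrite ltr_pdivlMr // => h.
exists K; have hb := @bin_exp_le1 R y B.+1 K.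
rewrite (ltW y0) (ltW y1) in hb; have {hb}hb := hb isT; rewrite addSnnS in hb.
apply: le_lt_trans h.
have -> : c * 'C(B + K.+1, B.+1)%:R * x ^+ K.+1 =
   x * (M * ('C(B + K.+1, B.+1)%:R * y ^+ K * (1 - y) ^+ B.+1) * (x / y) ^+ K).
  have uN0 : (1 - y) ^+ B.+1 != 0 by rewrite expf_neq0 ?gt_eqF.
  have yN0 : y ^+ K != 0 by rewrite expf_neq0 ?gt_eqF.
  rewrite /M [(x / y) ^+ K]expr_div_n (exprS x); move: ((1 - y) ^+ B.+1) (y ^+ K) uN0
    yN0 => u v uN0 vN0.
  by field; rewrite ?uN0 ?vN0.
apply: (@le_trans _ _ (M * ('C(B + K.+1, B.+1)%:R * y ^+ K * (1 - y) ^+ B.+1) * (x / y)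
  ^+ K)).
  apply: ler_piMl; last exact: ltW.
  apply: mulr_ge0 => //; apply: mulr_ge0 => //.
  by apply: mulr_ge0; [apply: mulr_ge0 => // | ]; apply: exprn_ge0; apply: ltW.
rewrite mulrC ler_wpM2l //.
apply: (@le_trans _ _ M); first by rewrite -[leRHS]mulr1 ler_wpM2l.
by rewrite lerDl.
Qed.

(** * From moment bounds to the second eigenvalue *)

Lemma normc_real (R : rcfType) (x : R) : `|x%:C| = `|x|%:C.
Proof. by rewrite normc_def /= expr0n addr0 sqrtr_sqr. Qed.

Lemma minor_sum_map (K L : comNzRingType) (f : {rmorphism K -> L}) (n k : nat) (A :
  'M[K]_n) :
  minor_sum (map_mx f A) k = f (minor_sum A k).
Proof.
rewrite /minor_sum rmorph_sum; apply: eq_bigr => u _.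
rewrite /minor -det_map_mx; congr (\det _).
by apply/matrixP => i j; rewrite !mxE.
Qed.

Lemma minor_sum_small (R : idomainType) (n k : nat) (A : 'M[R]_n) :
  (n < k)%N -> minor_sum A k = 0.
Proof.
move=> nk; apply: big1 => u _.
have [/injectiveP uI|/injectivePn[i [j ij uij]]] := boolP (injectiveb u).
  by have := leq_card u uI; rewrite !card_ord leqNgt nk.
exact: minor_eq0 ij uij.
Qed.

(** Here [x] stands for d a. Since d <= x^2, simple walks of length l number at most (b + 1) x^(2l),
    so the periodic ones add at most 2 (b + 1) x^k to the deviation b x^k of the simple ones: in
    total 3b + 2. *)
Lemma nb_walks_deviation (R : realFieldType) (n d k K : nat) (b x : R)
    (sigma : matching n d) :
  (0 < k <= K)%N -> 0 <= b -> d%:R <= x ^+ 2 -> (2 <= d)%N -> 0 < x ->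
  (forall j, (0 < j <= K)%N -> `|(nb_simple sigma j)%:R - d%:R ^+ j| <= b * x ^+ j) ->
  nb_tangled sigma k = 0%N ->
  `|(nb_walks sigma k)%:R - d%:R ^+ k| <= (3 * b + 2) * x ^+ k.
Proof.
move=> /andP[k0 kK] b0 dx d2 x0 simple_dev tangled0.
have dR2 : 2 <= d%:R :> R by rewrite (ler_nat R 2).
have dR0 : 0 <= d%:R :> R by rewrite ler0n.
have y2 : 2 <= x ^+ 2 by exact: le_trans dx.
have y0 : 0 <= x ^+ 2 by exact: le_trans y2.
have x1 : 1 <= x.
  rewrite leNgt; apply/negP => xlt; have : x ^+ 2 <= 1 by rewrite exprn_ile1 ?ltW.
  by move=> ?; lra.
have simple_le j : (0 < j <= K)%N -> (nb_simple sigma j)%:R <= (b + 1) * (x ^+ 2) ^+ j.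
  move=> jK; have := simple_dev j jK; rewrite ler_norml => /andP[_].
  rewrite lerBlDr => h; apply: (le_trans h).
  rewrite mulrDl mul1r lerD //.
    by rewrite ler_wpM2l // -exprM ler_weXn2l // mul2n -addnn leq_addr.
  by rewrite lerXn2r // ?nnegrE.
have periodic_le : (\sum_(1 <= l < k./2.+1) nb_simple sigma l)%N%:R <= 2 * (b + 1) * x
  ^+ k.
  have geom m : \sum_(1 <= l < m.+1) (x ^+ 2) ^+ l <= 2 * (x ^+ 2) ^+ m.
    elim: m => [|m IHm]; first by rewrite big_geq // expr0 mulr1.
    rewrite big_nat_recr //= ; have : 2 * (x ^+ 2) ^+ m <= (x ^+ 2) ^+ m.+1.
      by rewrite [leRHS]exprS ler_wpM2r // exprn_ge0.
    by move=> ?; lra.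
  rewrite natr_sum; apply: (@le_trans _ _ (\sum_(1 <= l < k./2.+1) (b + 1) * (x ^+ 2)
    ^+ l)).
    rewrite big_nat_cond [leRHS]big_nat_cond; apply: ler_sum => l /andP[/andP[l1 lk] _].
    by apply: simple_le; lia.
  rewrite -mulr_sumr [2 * (b + 1)]mulrC -[leRHS]mulrA; apply: ler_wpM2l; first by
    rewrite addr_ge0.
  apply: (le_trans (geom _)); rewrite ler_wpM2l // -exprM ler_weXn2l //.
  by lia.
have := nb_walks_le sigma k; rewrite tangled0 addn0 -(ler_nat R) natrD => up.
have := nb_simple_le sigma k; rewrite -(ler_nat R) => low.
have := simple_dev k; rewrite k0 kK => /(_ isT); rewrite !ler_norml => /andP[h1 h2].
have xk0 : 0 <= x ^+ k by rewrite exprn_ge0 // ltW.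
have bx0 : 0 <= b * x ^+ k by rewrite mulr_ge0.
move: (x ^+ k) xk0 bx0 h1 h2 periodic_le => X *; apply/andP; split; lra.
Qed.

Lemma second_eigenvalue_lt (R : realType) (n d K b : nat) (a rho : R)
    (sigma : matching n d) (l : seq R[i]) :
  (0 < n)%N -> (2 <= d)%N -> 0 < a -> a < rho -> 1 <= d%:R * a ^+ 2 ->
  b%:R * 'C((3 * b + 2) + K.+1, (3 * b + 2).+1)%:R * (a / rho) ^+ K.+1 < 1 - a / rho ->
  (forall i, `|minor_sum (centered_transition R sigma) i| <= i`!%:R * (b%:R * a ^+ i)) ->
  (forall k, (0 < k <= K)%N ->
     `|(nb_simple sigma k)%:R - d%:R ^+ k| <= b%:R * (d%:R * a) ^+ k) ->
  (forall k, (0 < k <= K)%N -> nb_tangled sigma k = 0%N) ->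
  ordered_spectrum (transition_matrix R sigma) l ->
  `|l`_1| < rho%:C.
Proof.
move=> n0 d2 a0 arho da small minors simple_dev tangled0 [lP _ l0].
have rho0 : 0 < rho by exact: lt_trans arho.
have d0 : (0 < d)%N by exact: ltnW.
have dR0 : 0 < d%:R :> R by rewrite ltr0n.
case: l lP l0 => [|z0 l] lP /= l0; first by case/eqP: (oner_neq0 R[i]); rewrite -l0.
rewrite {z0}l0 in lP.
(* For [n = 1] there is no second eigenvalue and the entry read is the default 0. *)
have [lsz|lsz] := leqP (size l) 0; first by rewrite nth_default // normr0 ltcR.
have lP' : char_poly (transition_matrix R sigma) = ('X - 1) * \prod_(z <- l) ('X - z%:P).
  by rewrite lP big_cons polyC1.
have := char_poly_centered n0 d0 lP'.
set B := map_mx _ _ => BP.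
have BP0 : char_poly B = \prod_(z <- 0 :: l) ('X - z%:P).
  by rewrite BP big_cons subr0.
(* The eigenvalue 0 that replaced 1 contributes the factor 1 to the reversed polynomial. *)
have coefE i : (rev_char l)`_i = (-1) ^+ i * minor_sum B i / i`!%:R.
  rewrite (minor_sum_char_poly i BP0) big_cons scale0r subr0 mul1r -/(rev_char l).
  rewrite !mulrA -exprD -signr_odd oddD addbb expr0 mul1r mulrAC divff ?mul1r //
    pnatr_eq0 -lt0n fact_gt0.
apply: (@zero_free _ K (3 * b + 2) l a%:C rho%:C b%:R) => //; last exact: mem_nth.
- by rewrite ltcR.
- by rewrite ltcR.
- move=> i; rewrite coefE /B minor_sum_map !normrM normfV normrX normrN1 expr1n mul1r
  normc_real.
  rewrite normr_nat ler_pdivrMr ?ltr0n ?fact_gt0 // mulrC.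
  by rewrite -!(rmorph_nat (real_complex R)) -rmorphXn -!rmorphM lecR minors.
- move=> k kK; have k0 := (andP kK).1.
  have -> : \sum_(z <- l) z ^+ k = (((nb_walks sigma k)%:R - d%:R ^+ k) / d%:R ^+ k :
    R)%:C.
    have := mxtrace_char_poly k lP; rewrite mxtrace_transition_matrixX // big_cons
      expr1n => e.
    have -> : \sum_(z <- l) z ^+ k = (nb_walks sigma k)%:R / d%:R ^+ k - 1.
      by rewrite e [X in X - 1]addrC addrK.
    rewrite mulrBl divff ?expf_neq0 ?gt_eqF //.
    by rewrite rmorphB rmorphM fmorphV rmorphXn !rmorph_nat rmorph1.
  have -> : (3 * b + 2)%:R * a%:C ^+ k = ((3 * b + 2)%:R * a ^+ k)%:C.
    by rewrite rmorphM rmorphXn rmorph_nat.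
  rewrite normc_real lecR.
  rewrite normrM normfV [`|d%:R ^+ k|]ger0_norm ?exprn_ge0 ?ler0n //.
  rewrite ler_pdivrMr ?exprn_gt0 // -mulrA -exprMn [a * _]mulrC natrD natrM.
  apply: (@nb_walks_deviation _ _ _ _ K) => //.
  + by rewrite exprMn expr2 -mulrA -[leLHS]mulr1 ler_pM2l.
  + by rewrite mulr_gt0.
  + exact: tangled0.
- have -> : b%:R * 'C(3 * b + 2 + K.+1, (3 * b + 2).+1)%:R * (a%:C / rho%:C) ^+ K.+1 =
      (b%:R * 'C(3 * b + 2 + K.+1, (3 * b + 2).+1)%:R * (a / rho) ^+ K.+1)%:C.
    by rewrite !(rmorphM, rmorphXn, fmorphV, rmorph_nat).
  have -> : 1 - a%:C / rho%:C = (1 - a / rho)%:C.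
    by rewrite rmorphB rmorphM fmorphV rmorph1.
  by rewrite ltcR.
Qed.

(** * Markov's inequality and conclusion *)

Lemma finite_markov (R : realType) (T : finType) (A : {set T}) (Y : T -> R) :
  (0 < #|T|)%N -> (forall t, 0 <= Y t) -> (forall t, t \notin A -> 1 <= Y t) ->
  1 - finite_uniform_prob R A <= (\sum_t Y t) / #|T|%:R.
Proof.
move=> T0 Y0 Y1; have T0R : 0 < #|T|%:R :> R by rewrite ltr0n.
rewrite ler_pdivlMr // mulrBl mul1r divfK ?gt_eqF // -(cardsC A) natrD addrAC subrr add0r.
rewrite -sum1_card natr_sum [leRHS](bigID (mem A)) /= -[leLHS]add0r lerD //.
  by rewrite sumr_ge0.
rewrite big_mkcond [leRHS]big_mkcond /=; apply: ler_sum => t _.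
by rewrite inE; case: ifPn => //= /Y1.
Qed.

Section Badness.
Variables (R : realType) (n d K b : nat) (a : R).
Hypotheses (n0 : (0 < n)%N) (d0 : (0 < d)%N) (b0 : (0 < b)%N) (a0 : 0 < a).

(* If this nonnegative variable is less than 1, then all the estimates needed on
   [sigma] hold, so a single use of Markov's inequality suffices. *)
Definition badness (sigma : matching n d) : R :=
  \sum_(i < n.+1)
    (minor_sum (centered_transition R sigma) i / (i`!%:R * (b%:R * a ^+ i))) ^+ 2 +
  \sum_(i < K)
    ((((nb_simple sigma i.+1)%:R - d%:R ^+ i.+1) / (b%:R * (d%:R * a) ^+ i.+1)) ^+ 2 +
     (nb_tangled sigma i.+1)%:R).

Lemma badness_lt1 (sigma : matching n d) : badness sigma < 1 ->
  [/\ forall i, `|minor_sum (centered_transition R sigma) i| <= i`!%:R * (b%:R * a ^+ i),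
      forall k, (0 < k <= K)%N ->
        `|(nb_simple sigma k)%:R - d%:R ^+ k| <= b%:R * (d%:R * a) ^+ k
    & forall k, (0 < k <= K)%N -> nb_tangled sigma k = 0%N].
Proof.
have sqr_lt1 (x c : R) : 0 < c -> (x / c) ^+ 2 < 1 -> `|x| <= c.
  move=> c0; rewrite -[(x / c) ^+ 2]ger0_norm ?sqr_ge0 // normrX => h.
  have : `|x / c| < 1 by rewrite -(ltr_pXn2r (n := 2)) ?expr1n ?nnegrE.
  by rewrite normrM normfV (ger0_norm (ltW c0)) ltr_pdivrMr // mul1r => /ltW.
have bR0 : 0 < b%:R :> R by rewrite ltr0n.
have dR0 : 0 < d%:R :> R by rewrite ltr0n.
rewrite /badness; set S1 := (X in X + _); set S2 := (X in _ + X) => bad1.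
have S1_ge0 : 0 <= S1 by rewrite sumr_ge0 // => i _; rewrite sqr_ge0.
have S2_ge0 : 0 <= S2 by rewrite sumr_ge0 // => i _; rewrite addr_ge0 ?sqr_ge0.
have S1_lt1 : S1 < 1 by apply: le_lt_trans bad1; rewrite lerDl.
have S2_lt1 : S2 < 1 by apply: le_lt_trans bad1; rewrite lerDr.
have term2 k (kK : (0 < k <= K)%N) :
    (((nb_simple sigma k)%:R - d%:R ^+ k) / (b%:R * (d%:R * a) ^+ k)) ^+ 2 +
     (nb_tangled sigma k)%:R < 1 :> R.
  case: k kK => // k /= kK; apply: le_lt_trans S2_lt1.
  rewrite /S2 (bigD1 (Ordinal kK)) //= lerDl sumr_ge0 // => i _.
  by rewrite addr_ge0 ?sqr_ge0.
split=> [i|k kK|k kK].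
- have [ni|ni] := leqP i n; last first.
    (* Minors of size above n vanish, so the finite sum in [badness] controls every degree. *)
    by rewrite minor_sum_small // normr0 !mulr_ge0 // exprn_ge0 // ltW.
  apply: sqr_lt1; first by rewrite !mulr_gt0 ?exprn_gt0 ?ltr0n ?fact_gt0.
  apply: le_lt_trans S1_lt1; rewrite /S1 (bigD1 (Ordinal (ni : (i < n.+1)%N))) //= lerDl.
  by rewrite sumr_ge0 // => j _; rewrite sqr_ge0.
- apply: sqr_lt1; first by rewrite mulr_gt0 ?exprn_gt0 ?mulr_gt0.
  by apply: le_lt_trans (term2 k kK); rewrite lerDl.
- have : (nb_tangled sigma k)%:R < 1 :> R.
    by apply: le_lt_trans (term2 k kK); rewrite lerDr sqr_ge0.
  by rewrite -[1]/(1%:R) ltr_nat ltnS leqn0 => /eqP.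
Qed.

Lemma badness_ge0 (sigma : matching n d) : 0 <= badness sigma.
Proof.
rewrite /badness addr_ge0 ?sumr_ge0 // => i _; first by rewrite sqr_ge0.
by rewrite addr_ge0 ?sqr_ge0.
Qed.

Definition badness_error : R :=
  \sum_(i < K) ((variance_error d i.+1)%:R / (b%:R * (d%:R * a) ^+ i.+1) ^+ 2 +
    (2 ^ i.+1 * d ^ i.+1 * i.+1`!)%N%:R).

(** The bracket stays bounded in n and K, so the first part is made small by b alone; the second
    part vanishes as n grows with K and b fixed. *)
Lemma mean_badness_le : (2 <= d)%N -> (4 * K <= n)%N ->
  (\sum_sigma badness sigma) / (n * d)`!%:R <=
  b%:R ^- 2 * (\sum_(i < n.+1) ((d%:R * a ^+ 2)^-1) ^+ i +
     \sum_(i < K.+1) i%:R ^+ 2 * ((d%:R * a ^+ 2)^-1) ^+ i) +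
  badness_error / n%:R.
Proof.
move=> d2 Kn; have M0 : 0 < (n * d)`!%:R :> R by rewrite ltr0n fact_gt0.
have bR0 : 0 < b%:R :> R by rewrite ltr0n.
have dR0 : 0 < d%:R :> R by rewrite ltr0n.
have nR0 : 0 < n%:R :> R by rewrite ltr0n.
rewrite ler_pdivrMr //.
rewrite /badness big_split /= exchange_big /= [X in _ + X <= _]exchange_big /=.
rewrite mulrDl mulrDr mulrDl -addrA lerD //.
  rewrite mulr_sumr mulr_suml; apply: ler_sum => i _.
  have i0 : 0 < i`!%:R :> R by rewrite ltr0n fact_gt0.
  under eq_bigr do rewrite expr_div_n.
  rewrite -mulr_suml ler_pdivrMr ?exprn_gt0 ?mulr_gt0 ?exprn_gt0 //.
  apply: le_trans (second_moment_minor_sum R n0 d0 _) _.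
    (* The degree [i = n] is allowed because d >= 2. *)
    by apply: leq_ltn_trans (leq_ord i) _; rewrite -[X in (X < _)%N]muln1 ltn_pmul2l.
  rewrite le_eqVlt; apply/orP; left; apply/eqP.
  rewrite exprVn exprMn [(a ^+ 2) ^+ i]exprAC.
  have ai : a ^+ i != 0 by rewrite !expf_neq0 ?gt_eqF.
  have di : d%:R ^+ i != 0 :> R by rewrite expf_neq0 ?gt_eqF.
  move: (a ^+ i) (d%:R ^+ i : R) ai di => A D ai di.
  by field; rewrite ai di gt_eqF.
rewrite big_ord_recl expr0n mul0r add0r mulr_sumr mulr_suml /badness_error !mulr_suml
  -big_split /=.
apply: ler_sum => i _; rewrite /bump /= add1n big_split /=.
have Ci0 : 0 < (b%:R * (d%:R * a) ^+ i.+1) ^+ 2 :> R.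
  by rewrite exprn_gt0 // mulr_gt0 // exprn_gt0 // mulr_gt0.
have iKn : (2 * (i.+1 + i.+1) <= n * d)%N.
  have := ltn_ord i; nia.
rewrite mulrDl [X in _ <= _ + X]mulrDl addrA lerD //.
  under eq_bigr do rewrite expr_div_n.
  rewrite -mulr_suml ler_pdivrMr //.
  apply: le_trans (variance_nb_simple R n0 d0 iKn) _.
  rewrite le_eqVlt; apply/orP; left; apply/eqP.
  rewrite exprVn !exprMn.
  have ai : a ^+ i.+1 != 0 by rewrite !expf_neq0 ?gt_eqF.
  have di : d%:R ^+ i.+1 != 0 :> R by rewrite expf_neq0 ?gt_eqF.
  move: (a ^+ i.+1) (d%:R ^+ i.+1 : R) ai di => A D ai di.
  by field; rewrite ai di !gt_eqF.
rewrite -natr_sum mulrAC ler_pdivlMr // mulrC -!natrM ler_nat.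
by apply: sum_nb_tangled_le => //; lia.
Qed.

End Badness.

Theorem corollary1p2 (R : realType) (d : nat) (d_ge2 : (2 <= d)%N)
    (lambda : forall n : nat, matching n d -> seq R[i])
    (lambdaP : forall (n : nat) (sigma : matching n d), (0 < n)%N ->
       ordered_spectrum (transition_matrix R sigma) (lambda n sigma))
    (eps : R) (eps_gt0 : 0 < eps) :
  (fun n : nat => finite_uniform_prob R
     [set sigma : matching n d |
        `|(lambda n sigma)`_1| <= ((Num.sqrt d%:R)^-1 + eps)%:C]%SET)
    @ \oo --> (1 : R).
Proof.
have d0 : (0 < d)%N := ltnW d_ge2.
have dR0 : 0 < d%:R :> R by rewrite ltr0n.
have s0 : 0 < (Num.sqrt d%:R)^-1 :> R by rewrite invr_gt0 sqrtr_gt0.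
pose rho : R := (Num.sqrt d%:R)^-1 + eps.
(* The midpoint leaves room on both sides: [a] above 1/sqrt d gives [beta < 1], and [a < rho] makes
   the tail series converge. *)
pose a : R := (Num.sqrt d%:R)^-1 + eps / 2.
have a0 : 0 < a by rewrite addr_gt0 // divr_gt0.
have arho : a < rho by rewrite /a /rho ltrD2l; lra.
have rho0 : 0 < rho by exact: lt_trans arho.
have da : 1 < d%:R * a ^+ 2.
  have e : d%:R * (Num.sqrt d%:R)^-1 ^+ 2 = 1 :> R.
    by rewrite exprVn sqr_sqrtr ?ltW // divff ?gt_eqF.
  by rewrite -[ltLHS]e ltr_pM2l // ltrXn2r // ?nnegrE ?(ltW s0) ?(ltW a0) // ltrDl
    divr_gt0.
pose beta : R := (d%:R * a ^+ 2)^-1.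
have beta0 : 0 < beta by rewrite invr_gt0 (lt_trans ltr01).
have beta1 : beta < 1 by rewrite invf_lt1 // (lt_trans ltr01).
have [S2 S2P] : exists S : R, forall m, \sum_(i < m) i%:R ^+ 2 * beta ^+ i <= S.
  by apply: sum_sqr_geom_bounded; rewrite beta0.
have S1P m : \sum_(i < m) beta ^+ i <= (1 - beta)^-1.
  by apply: sum_geom_le; rewrite (ltW beta0).
set S1 := (1 - beta)^-1 in S1P.
apply/cvgrPdist_le => eta eta0.
have S0 : 0 <= S1 + S2.
  by apply: (le_trans _ (lerD (S1P 0%N) (S2P 0%N))); rewrite !big_ord0 addr0.
(* As b^(-2) <= b^(-1), this makes the part of the mean not decaying in n at most [eta / 2]. *)
pose b := (Num.trunc (2 * (S1 + S2) / eta)).+1.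
have b_large : 2 * (S1 + S2) / eta < b%:R by exact: truncnS_gt.
have b1 : 1 <= b%:R :> R by rewrite (ler_nat R 1).
have ratio : 0 < a / rho < 1 by rewrite divr_gt0 //= ltr_pdivrMr // mul1r.
(* [3 * b + 2] is the power sum constant once periodic walks are included. *)
have [K small] := exists_bin_exp_lt (3 * b + 2) (ler0n R b) ratio.
pose W := badness_error d K b a.
pose n1 := (Num.trunc (2 * W / eta)).+1.
(* [n1] makes W / n at most [eta / 2]; the other bound gives the walk estimates their room and
   ensures n > 0. *)
exists (maxn n1 (4 * K).+1) => // n /=; rewrite geq_max => /andP[n1n Kn].
have n0 : (0 < n)%N by exact: leq_trans Kn.
have nR0 : 0 < n%:R :> R by rewrite ltr0n.
set A := [set sigma | _]%SET.
have cardT : #|matching n d| = (n * d)`! by rewrite card_permT card_half_edge.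
have T0 : (0 < #|matching n d|)%N by rewrite cardT fact_gt0.
have prob_le1 : finite_uniform_prob R A <= 1.
  by rewrite ler_pdivrMr ?ltr0n // mul1r ler_nat max_card.
rewrite ger0_norm ?subr_ge0 //.
apply: le_trans (finite_markov (Y := badness K b a) T0 _ _) _.
- by move=> sigma; exact: badness_ge0.
- move=> sigma; rewrite inE; apply: contraNle => /(badness_lt1 d0 (ltn0Sn _) a0)[h1 h2
  h3].
  apply: ltW; apply: (second_eigenvalue_lt n0 d_ge2 a0 arho (ltW da) small h1 h2 h3).
  exact: lambdaP.
rewrite cardT; apply: le_trans (mean_badness_le n0 d0 (ltn0Sn _) a0 d_ge2 (ltnW Kn)) _.
rewrite [leRHS](_ : eta = eta / 2 + eta / 2); last by lra.
apply: lerD.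
  apply: (@le_trans _ _ (b%:R ^- 2 * (S1 + S2))).
    apply: ler_wpM2l; first by rewrite invr_ge0 exprn_ge0.
    by apply: lerD; [exact: S1P | exact: S2P].
  rewrite mulrC ler_pdivrMr ?exprn_gt0 ?(lt_le_trans ltr01) //.
  have : (S1 + S2) <= eta / 2 * b%:R.
    by move: b_large; rewrite ltr_pdivrMr // => h; lra.
  move/le_trans; apply; rewrite ler_wpM2l ?divr_ge0 ?(ltW eta0) //.
  by rewrite expr2 -[leLHS]mulr1 ler_wpM2l.
rewrite -/W ler_pdivrMr //.
have : 2 * W / eta < n1%:R by exact: truncnS_gt.
have : n1%:R <= n%:R :> R by rewrite ler_nat.
move=> h /lt_le_trans/(_ h); rewrite ltr_pdivrMr // => h'; lra.
Qed.
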